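(* Let $({}_{f_2}M_1\times{}_{f_1}M_2,F)$ be a doubly warped product Finsler manifold. The foliated manifold $(TM^\circ,\mathcal{F}_V,\mathbf{G})$ is a Reinhart space if and only if $(M_1,F_1)$ and $(M_2,F_2)$ are Riemannian manifolds.
   Context: A Finsler metric on a manifold $M$ is a function $F:TM\to[0,\infty)$ that is $C^\infty$ on the slit tangent bundle $TM^\circ$, positively $1$-homogeneous on fibres, and whose fibre Hessian of $\frac12F^2$ is positive definite; it is Riemannian if and only if its Cartan tensor $\frac12\frac{\partial g_{ij}}{\partial y^k}$ vanishes, where $g_{ij}=\frac12\frac{\partial^2F^2}{\partial y^i\partial y^j}$. Let $(M_1,F_1)$, $(M_2,F_2)$ be Finsler manifolds and let $f_1:M_1\to\mathbb{R}^+$, $f_2:M_2\to\mathbb{R}^+$ be smooth. The doubly warped product Finsler manifold $({}_{f_2}M_1\times{}_{f_1}M_2,F)$ is $M=M_1\times M_2$ with $$F(v_1,v_2)=\sqrt{f_2^2(\pi_2(v_2))F_1^2(v_1)+f_1^2(\pi_1(v_1))F_2^2(v_2)},\qquad (v_1,v_2)\in TM^\circ:=TM_1^\circ\times TM_2^\circ,$$ where $\pi_1,\pi_2$ are the base-point projections. In induced coordinates $(\mathbf{x}^a,\mathbf{y}^a)$ on $TM$ put $\mathbf{g}_{ab}=\frac12\frac{\partial^2F^2}{\partial\mathbf{y}^a\partial\mathbf{y}^b}$ with inverse $\mathbf{g}^{ab}$, $\mathbf{G}^a=\frac14\mathbf{g}^{ab}\big(\frac{\partial^2F^2}{\partial\mathbf{y}^b\partial\mathbf{x}^c}\mathbf{y}^c-\frac{\partial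 F^2}{\partial\mathbf{x}^b}\big)$, $\mathbf{G}^a_b=\frac{\partial\mathbf{G}^a}{\partial\mathbf{y}^b}$, $\frac{\delta^d}{\delta^d\mathbf{x}^a}=\frac{\partial}{\partial\mathbf{x}^a}-\mathbf{G}^b_a\frac{\partial}{\partial\mathbf{y}^b}$ (the superscript $d$ is a label). $VTM^\circ=\mathrm{span}\{\frac{\partial}{\partial\mathbf{y}^a}\}$ (structural bundle), $HTM^\circ=\mathrm{span}\{\frac{\delta^d}{\delta^d\mathbf{x}^a}\}$ (transversal bundle), $TTM^\circ=HTM^\circ\oplus VTM^\circ$, with projections $h^d$ onto $HTM^\circ$ and $v^d$ onto $VTM^\circ$; $\mathcal{F}_V$ is the foliation of $TM^\circ$ tangent to $VTM^\circ$. The doubly warped Sasaki–Matsumoto metric is the Riemannian metric $\mathbf{G}=\mathbf{g}_{ab}\,d\mathbf{x}^a\otimes d\mathbf{x}^b+\mathbf{g}_{ab}\,\delta^d\mathbf{y}^a\otimes\delta^d\mathbf{y}^b$ on $TM^\circ$, $\delta^d\mathbf{y}^a=d\mathbf{y}^a+\mathbf{G}^a_b\,d\mathbf{x}^b$. The Vaisman connection $\nabla^v$ on $(TM^\circ,\mathcal{F}_V,\mathbf{G})$ is the linear connection uniquely determined by: (i) if $Y\in\Gamma(VTM^\circ)$ (resp. $\Gamma(HTM^\circ)$) then $\nabla^v_XY\in\Gamma(VTM^\circ)$ (resp. $\Gamma(HTM^\circ)$) for every $X$; (ii) if $X,Y,Z\in\Gamma(VTM^\circ)$, or $X,Y,Z\in\Gamma(HTM^\circ)$,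 then $(\nabla^v_X\mathbf{G})(Y,Z)=0$; (iii) with $T$ the torsion of $\nabla^v$, $v^d(T(X,Y))=0$ if at least one of $X,Y$ is in $\Gamma(VTM^\circ)$, and $h^d(T(X,Y))=0$ if at least one of $X,Y$ is in $\Gamma(HTM^\circ)$. The foliated manifold $(TM^\circ,\mathcal{F}_V,\mathbf{G})$ is a Reinhart space if $(\nabla^v_X\mathbf{G})(Y,Z)=0$ for all sections $X$ of the structural bundle $VTM^\circ$ and all sections $Y,Z$ of the transversal bundle $HTM^\circ$. *)

(* Defs.v *)
(* MathComp-Analysis; the real line is an arbitrary realType R *)
From HB Require Import structures.
From mathcomp Require Import all_boot all_order all_algebra.
From mathcomp Require Import all_classical all_reals all_analysis.
Set Implicit Arguments.
Unset Strict Implicit.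
Unset Printing Implicit Defensive.
Import Order.TTheory GRing.Theory Num.Theory.
Import numFieldNormedType.Exports.
Local Open Scope classical_set_scope.
Local Open Scope ring_scope.

Section Manifolds.
Variable R : realType.

(* C^k on an open set U (meaningful only for U open) *)
Fixpoint Ck (k n : nat) (W : normedModType R) (U : set 'rV[R]_n)
    (f : 'rV[R]_n -> W) : Prop :=
  if k is k'.+1 then
    (forall x, U x -> differentiable f x) /\
    (forall v : 'rV[R]_n, Ck k' U (fun x => 'D_v f x))
  else forall x, U x -> {for x, continuous f}.

Definition smooth_on (n : nat) (W : normedModType R) (U : set 'rV[R]_n)
    (f : 'rV[R]_n -> W) : Prop := forall k, Ck k U f.

(* Raw chart data on a set T: an indexed family of charts (only the values of
   [cmap c] on [cdom c] matter), and a preferred chart at each point. The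
   tangent space at p is 'rV_n, a vector being given by its components in the
   preferred chart at p; its components in other charts are obtained through
   the derivatives of the transition maps, see [tmap]. *)
Record charted (T : choiceType) (n : nat) := Charted {
  cidx : Type;
  cdom : cidx -> set T;
  cmap : cidx -> T -> 'rV[R]_n;
  chart_at : T -> cidx }.

Section Charts.
Variables (T : choiceType) (n : nat) (M : charted T n).

Definition cimg (c : cidx M) : set 'rV[R]_n := cmap c @` cdom c.

(* u o c^-1 on the image of the chart c, 0 elsewhere *)
Definition crep (W : normedModType R) (c : cidx M) (u : T -> W) (z : 'rV[R]_n)
  : W := xget 0 (u @` (cdom c `&` [set p | cmap c p = z])).

Definition smooth_fun (W : normedModType R) (u : T -> W) : Prop :=
  forall c, smooth_on (cimg c) (crep c u).

(* the differential of u at p, applied to the tangent vector zeta at p *)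
Definition tmap (W : normedModType R) (u : T -> W) (p : T) (zeta : 'rV[R]_n)
  : W := 'D_zeta (crep (chart_at M p) u) (cmap (chart_at M p) p).

(* the induced chart (x, y) of the tangent bundle, as a row vector in
   'rV_(n + n) *)
Definition tbundle : charted (T * 'rV[R]_n)%type (n + n) :=
  @Charted _ (n + n) (cidx M)
    (fun c => [set v | cdom c v.1])
    (fun c v => row_mx (cmap c v.1) (tmap (cmap c) v.1 v.2))
    (fun v => chart_at M v.1).

Definition submanifold (P : pred T) : charted {p : T | P p} n :=
  @Charted _ n (cidx M)
    (fun c => [set p | cdom c (val p)])
    (fun c p => cmap c (val p))
    (fun p => chart_at M (val p)).

End Charts.

Definition prod_charted (T1 T2 : choiceType) (n1 n2 : nat) (M1 : charted T1 n1)
    (M2 : charted T2 n2) : charted (T1 * T2)%type (n1 + n2) :=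
  @Charted _ (n1 + n2) (cidx M1 * cidx M2)%type
    (fun c => cdom c.1 `*` cdom c.2)
    (fun c p => row_mx (cmap c.1 p.1) (cmap c.2 p.2))
    (fun p => (chart_at M1 p.1, chart_at M2 p.2)).

(* By [chart_inj], [chart_continuous] and [chart_open_map], each chart is a
   homeomorphism of an open set onto an open subset of R^n. The topology of T is
   only needed here: smoothness is read in the charts. *)
Record smooth_manifold (T : topologicalType) (n : nat) (M : charted T n)
  : Prop := SmoothManifold {
  manifold_hausdorff : hausdorff_space T;
  manifold_countable : @second_countable T;
  chart_open : forall c : cidx M, open (cdom c);
  chart_inj : forall (c : cidx M) p q,
    cdom c p -> cdom c q -> cmap c p = cmap c q -> p = q;
  chart_continuous : forall (c : cidx M) p,
    cdom c p -> {for p, continuous (cmap c)};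
  chart_open_map : forall (c : cidx M) (A : set T),
    open A -> A `<=` cdom c -> open (cmap c @` A);
  chart_at_dom : forall p, cdom (chart_at M p) p;
  chart_transition : forall c c' : cidx M,
    smooth_on (cmap c @` (cdom c `&` cdom c')) (crep c (cmap c')) }.

Section Connections.
Variables (T : choiceType) (m : nat) (S : charted T m).

Definition vfield (_ : charted T m) := T -> 'rV[R]_m.

Definition connection (S' : charted T m) :=
  vfield S' -> vfield S' -> vfield S'.

Definition distribution (_ : charted T m) := T -> {vspace 'rV[R]_m}.

(* components of X in the chart c *)
Definition vcomp (c : cidx S) (X : vfield S) : T -> 'rV[R]_m :=
  fun p => tmap S (cmap c) p (X p).

Definition smooth_vfield (X : vfield S) : Prop :=
  forall c : cidx S, smooth_on (cimg c) (crep c (vcomp c X)).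

Definition vf_act (X : vfield S) (u : T -> R) : T -> R :=
  fun p => tmap S u p (X p).

(* [X, Y]^i = X(Y^i) - Y(X^i) in the preferred chart at p *)
Definition bracket (X Y : vfield S) : vfield S := fun p =>
  tmap S (vcomp (chart_at S p) Y) p (X p) -
  tmap S (vcomp (chart_at S p) X) p (Y p).

Record linear_connection (nabla : connection S) : Prop :=
  LinearConnection {
  conn_smooth : forall X Y, smooth_vfield X -> smooth_vfield Y ->
    smooth_vfield (nabla X Y);
  conn_tensorial : forall (u : T -> R) X X' Y, smooth_fun S u ->
    smooth_vfield X -> smooth_vfield X' -> smooth_vfield Y -> forall p,
    nabla (fun q => u q *: X q + X' q) Y p = u p *: nabla X Y p + nabla X' Y p;
  conn_additive : forall X Y Y', smooth_vfield X -> smooth_vfield Y ->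
    smooth_vfield Y' -> forall p,
    nabla X (fun q => Y q + Y' q) p = nabla X Y p + nabla X Y' p;
  conn_leibniz : forall (u : T -> R) X Y, smooth_fun S u -> smooth_vfield X ->
    smooth_vfield Y -> forall p,
    nabla X (fun q => u q *: Y q) p = u p *: nabla X Y p + vf_act X u p *: Y p }.

Definition torsion (nabla : connection S) (X Y : vfield S) : vfield S :=
  fun p => nabla X Y p - nabla Y X p - bracket X Y p.

Definition nabla_metric (nabla : connection S)
    (G : T -> 'rV[R]_m -> 'rV[R]_m -> R) (X Y Z : vfield S) : T -> R := fun p =>
  vf_act X (fun q => G q (Y q) (Z q)) p
  - G p (nabla X Y p) (Z p) - G p (Y p) (nabla X Z p).

Definition is_section (D : distribution S) (X : vfield S) : Prop :=
  smooth_vfield X /\ forall p, X p \in D p.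

(* V is the structural bundle, H the transversal one; [daddv_pi (V p) (H p)] is
   the projection onto V p along H p *)
Record vaisman_connection (V H : distribution S)
    (G : T -> 'rV[R]_m -> 'rV[R]_m -> R) (nabla : connection S)
  : Prop := VaismanConnection {
  vaisman_linear : linear_connection nabla;
  vaisman_structural : forall X Y, smooth_vfield X -> is_section V Y ->
    is_section V (nabla X Y);
  vaisman_transversal : forall X Y, smooth_vfield X -> is_section H Y ->
    is_section H (nabla X Y);
  vaisman_metric_structural : forall X Y Z, is_section V X -> is_section V Y ->
    is_section V Z -> forall p, nabla_metric nabla G X Y Z p = 0;
  vaisman_metric_transversal : forall X Y Z, is_section H X -> is_section H Y ->
    is_section H Z -> forall p, nabla_metric nabla G X Y Z p = 0;
  vaisman_torsion_structural : forall X Y, smooth_vfield X ->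
    smooth_vfield Y -> is_section V X \/ is_section V Y ->
    forall p, daddv_pi (V p) (H p) (torsion nabla X Y p) = 0;
  vaisman_torsion_transversal : forall X Y, smooth_vfield X ->
    smooth_vfield Y -> is_section H X \/ is_section H Y ->
    forall p, daddv_pi (H p) (V p) (torsion nabla X Y p) = 0 }.

(* [nabla] is meant to be the Vaisman connection of (V, H, G) *)
Definition reinhart_space (V H : distribution S)
    (G : T -> 'rV[R]_m -> 'rV[R]_m -> R) (nabla : connection S) : Prop :=
  forall X Y Z, is_section V X -> is_section H Y -> is_section H Z ->
  forall p, nabla_metric nabla G X Y Z p = 0.

End Connections.

(* Coordinate formulas: L is the coordinate expression of F^2 as a function of
   z = (x, y), and e_x a, e_y a are the coordinate fields d/dx^a, d/dy^a. *)
Section Coordinates.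
Variables (n : nat) (L : 'rV[R]_(n + n) -> R).
Implicit Types (z zeta : 'rV[R]_(n + n)) (a b c i j k : 'I_n).

Definition e_x a : 'rV[R]_(n + n) := row_mx (delta_mx 0 a) 0.
Definition e_y a : 'rV[R]_(n + n) := row_mx 0 (delta_mx 0 a).

Definition fund_tensor z : 'M[R]_n :=
  \matrix_(a, b) (2^-1 * 'D_(e_y a) ('D_(e_y b) L) z).

Definition cartan_tensor i j k z : R :=
  2^-1 * 'D_(e_y k) (fun z' => fund_tensor z' i j) z.

Definition spray a z : R :=
  4^-1 * \sum_b invmx (fund_tensor z) a b *
    (\sum_c 'D_(e_y b) ('D_(e_x c) L) z * rsubmx z 0 c - 'D_(e_x b) L z).

Definition nonlin_conn z : 'M[R]_n := \matrix_(a, b) 'D_(e_y b) (spray a) z.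

Definition delta_x z a : 'rV[R]_(n + n) :=
  e_x a - \sum_b nonlin_conn z b a *: e_y b.

(* the coframe element delta y^a evaluated on the tangent vector zeta *)
Definition delta_y z zeta a : R :=
  rsubmx zeta 0 a + \sum_b nonlin_conn z a b * lsubmx zeta 0 b.

Definition sasaki_matsumoto_at z zeta zeta' : R :=
  \sum_a \sum_b fund_tensor z a b * (lsubmx zeta 0 a * lsubmx zeta' 0 b) +
  \sum_a \sum_b fund_tensor z a b * (delta_y z zeta a * delta_y z zeta' b).

End Coordinates.

Section Finsler.
Variables (T : choiceType) (n : nat) (M : charted T n).

Definition slit : pred (T * 'rV[R]_n) := fun v => v.2 != 0.

Definition slit_tbundle := submanifold (tbundle M) slit.

Definition energy (F : T * 'rV[R]_n -> R) : {v | slit v} -> R :=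
  fun v => F (val v) ^+ 2.

Record finsler_metric (F : T * 'rV[R]_n -> R) : Prop := FinslerMetric {
  finsler_ge0 : forall v, 0 <= F v;
  finsler_smooth : smooth_fun slit_tbundle (F \o val);
  finsler_homogeneous : forall (l : R) p y, 0 < l ->
    F (p, l *: y) = l * F (p, y);
  finsler_convex : forall (c : cidx slit_tbundle) v, cdom c v ->
    forall xi : 'rV[R]_n, xi != 0 ->
    0 < (xi *m fund_tensor (crep c (energy F)) (cmap c v) *m xi^T) 0 0 }.

(* vanishing of the Cartan tensor on the whole slit tangent bundle *)
Definition is_riemannian (F : T * 'rV[R]_n -> R) : Prop :=
  forall (c : cidx slit_tbundle) v, cdom c v ->
  forall i j k, cartan_tensor (crep c (energy F)) i j k (cmap c v) = 0.

End Finsler.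

Section DoublyWarped.
Variables (T1 T2 : choiceType) (n1 n2 : nat).
Variables (M1 : charted T1 n1) (M2 : charted T2 n2).
Variables (F1 : T1 * 'rV[R]_n1 -> R) (F2 : T2 * 'rV[R]_n2 -> R).
Variables (f1 : T1 -> R) (f2 : T2 -> R).

Let TM := ((T1 * T2) * 'rV[R]_(n1 + n2))%type.

(* the identification T(M1 x M2) = TM1 x TM2; the slit bundle is cut out by [dw_slit], so
   that both components of a vector are nonzero *)
Definition tproj1 (v : TM) : T1 * 'rV[R]_n1 := (v.1.1, lsubmx v.2).
Definition tproj2 (v : TM) : T2 * 'rV[R]_n2 := (v.1.2, rsubmx v.2).

Definition dw_metric (v : TM) : R :=
  Num.sqrt (f2 (tproj2 v).1 ^+ 2 * F1 (tproj1 v) ^+ 2 +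
            f1 (tproj1 v).1 ^+ 2 * F2 (tproj2 v) ^+ 2).

Definition dw_slit : pred TM := fun v => slit (tproj1 v) && slit (tproj2 v).

Definition dw_tbundle : charted {v : TM | dw_slit v} _ :=
  submanifold (tbundle (prod_charted M1 M2)) dw_slit.

Let N := (n1 + n2 + (n1 + n2))%N.

(* coordinate expression of F^2, and coordinates of w, in the induced chart
   that is preferred at w *)
Definition dw_energy (w : {v : TM | dw_slit v}) : 'rV[R]_N -> R :=
  crep (chart_at dw_tbundle w) (fun w' => dw_metric (val w') ^+ 2).

Definition dw_coord (w : {v : TM | dw_slit v}) : 'rV[R]_N :=
  cmap (chart_at dw_tbundle w) w.

Definition dw_vertical : distribution dw_tbundle :=
  fun _ => <<[seq e_y a | a <- enum 'I_(n1 + n2)]>>%VS.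

Definition dw_horizontal : distribution dw_tbundle :=
  fun w => <<[seq delta_x (dw_energy w) (dw_coord w) a
             | a <- enum 'I_(n1 + n2)]>>%VS.

Definition sasaki_matsumoto (w : {v : TM | dw_slit v})
    (zeta zeta' : 'rV[R]_N) : R :=
  sasaki_matsumoto_at (dw_energy w) (dw_coord w) zeta zeta'.

End DoublyWarped.

End Manifolds.

(* Main.v *)
Require Import Defs.
From HB Require Import structures.
From mathcomp Require Import all_boot all_order all_algebra.
From mathcomp Require Import all_classical all_reals all_analysis.
From mathcomp Require Import ring zify.
Import Order.TTheory GRing.Theory Num.Theory.
Import numFieldNormedType.Exports.
Local Open Scope classical_set_scope.
Local Open Scope ring_scope.
Set Implicit Arguments.
Unset Strict Implicit.
Unset Printing Implicit Defensive.

(** For the Vaisman connection, a vertical [X] and horizontal [Y], [Z], the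
    transversal torsion condition says that [nabla_X Y] and [[X, Y]] have the
    same horizontal part, so [(nabla_X G)(Y, Z)] is the derivative of the
    fundamental tensor of [F] in the direction [X], evaluated on [Y] and [Z].
    The preferred chart is constant along a fibre of the tangent bundle, hence
    this is a computation in one chart. The square of [F] restricted to a fibre
    is [f2^2 F1^2 + f1^2 F2^2] with constant coefficients, so all its third
    fibre derivatives vanish if and only if those of [F1^2] and [F2^2] do.

    In the direct implication every triple of tangent vectors must be reached by
    global smooth sections. A bump function yields vector fields on the base
    with a prescribed value at a point; their vertical and horizontal lifts are
    smooth sections. That the horizontal lift does not depend on the chart rests
    on the Euler-Lagrange characterization of the spray [S = (y, -2 G)],
    [S (d(F^2)/dy) = d(F^2)/dx], which transforms well under changes of charts. *)

(** * Calculus in normed spaces *)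

(** The conditions on the connection speak of global smooth fields, whereas a horizontal vector is
    defined through the preferred chart at its base point, and preferred charts may jump from point
    to point. Smoothness of horizontal sections is thus the main obstacle: the lift has to be
    rewritten in an arbitrary fixed chart. The change of charts for the spray, differentiated once
    along the fibre, gives the one for horizontal lifts. It relies on an invertible fundamental
    tensor, which the product has because its fibre Hessian is block diagonal, with positive
    multiples of the two given Hessians as blocks.

    The metric on a pair with one horizontal member sees base components only. Differentiating the
    base components of a horizontal [Y] along a vertical [X] gives those of [[X, Y]], so in the
    product rule for [G(Y, Z)] everything cancels except the derivative of the fundamental tensor.
    Directions [(u, 0)] and [(0, u)] then separate the two factors, the other component of the point
    being any nonzero vector. *)

Section Calculus.
Variable R : realType.

Section Generic.
Variables (V W : normedModType R).

Lemma near_eq_differentiable (f g : V -> W) x :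
  {near x, f =1 g} -> differentiable f x -> differentiable g x.
Proof.
move=> fg df.
have gE : g \o shift x = cst (g x) + 'd f x +o_ 0 id.
  apply/eqaddoP => e e0; near=> h.
  have -> : (g \o shift x - (cst (g x) + 'd f x)) h =
    (f \o shift x - (cst (f x) + 'd f x)) h.
    rewrite !fctE /= (nbhs_singleton fg).
    congr (_ - _); apply/esym; near: h.
    by move: fg; rewrite (near_shift 0) subr0.
  by near: h; have /eqaddoP := diff_locally df; exact.
apply/diff_locallyP.
have dE : 'd g x = 'd f x :> (V -> W).
  by apply: diff_unique => //; exact: diff_continuous.
by rewrite dE; split=> //; exact: diff_continuous.
Unshelve. all: by end_near. Qed.

Lemma derive_comp_diff (U : normedModType R) (f : U -> V) (g : V -> W) x v :
  differentiable f x -> differentiable g (f x) ->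
  'D_v (g \o f) x = 'D_('D_v f x) g (f x).
Proof.
move=> df dg; rewrite (deriveE v df) (deriveE _ dg).
by rewrite (deriveE v (differentiable_comp df dg)) diff_comp.
Qed.

Lemma deriveDl (f : V -> W) x (a : R) u v : differentiable f x ->
  'D_(a *: u + v) f x = a *: 'D_u f x + 'D_v f x.
Proof. by move=> df; rewrite !(deriveE _ df) linearP. Qed.

Lemma derive_lin (f : {linear V -> W}) x v : continuous f -> 'D_v f x = f v.
Proof.
move=> cf; have df := @linear_differentiable _ _ _ f x cf.
by rewrite (deriveE v df) diff_lin.
Qed.

(* Only the difference quotients along the line are compared, so nothing is
   assumed about differentiability. *)
Lemma derive_line (V' : normedModType R) (f : V -> W) (g : V' -> W) x v x' v' :
  (forall h : R, f (h *: v + x) = g (h *: v' + x')) ->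
  'D_v f x = 'D_v' g x'.
Proof.
move=> fg; have fg0 : f x = g x' by have := fg 0; rewrite !scale0r !add0r.
rewrite /derive; set u := (fun h => _); set w := (fun h => _).
suff -> : u = w by [].
by apply/funext => h; rewrite /u /w /= fg fg0.
Qed.

Lemma near_line (P : set V) x v : (\forall y \near x, P y) ->
  \forall h \near (0 : R), P (h *: v + x).
Proof.
move=> Px.
have cl : (fun h : R => h *: v + x) @ 0 --> (0 : R) *: v + x.
  apply: cvgD; last exact: cvg_cst.
  exact: scalel_continuous.
by move: cl; rewrite scale0r add0r => /(_ _ Px).

Qed.

(** Agreement is asked on one segment only, not on a neighbourhood. This allows a function on the
    tangent bundle to be replaced by an expression that equals it on a single fibre. *)
Lemma near_derive_line (V' : normedModType R) (f : V -> W) (g : V' -> W)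
    x v x' v' :
  (\forall h \near (0 : R), f (h *: v + x) = g (h *: v' + x')) ->
  'D_v f x = 'D_v' g x'.
Proof.
move=> fg; have fg0 : f x = g x'.
  by move: (nbhs_singleton fg); rewrite !scale0r !add0r.
have E : \forall h \near (0 : R)^', h^-1 *: ((f \o shift x) (h *: v) - f x) =
   h^-1 *: ((g \o shift x') (h *: v') - g x').
  apply: cvg_within; apply: filterS fg => h /= ->; by rewrite fg0.
rewrite /derive; congr (lim _).
rewrite eqEsubset; split; apply/near_eq_cvg => //.
by near do apply/esym.
Unshelve. all: by end_near. Qed.

End Generic.

Lemma derive_coord n m (f : 'rV[R]_n -> 'rV[R]_m) x v i j :
  differentiable f x -> ('D_v f x) i j = 'D_v (fun y => f y i j) x.
Proof. by move=> df; rewrite derive_mx ?mxE//; exact: diff_derivable. Qed.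

Lemma derive_sum_delta n (W : normedModType R) (f : 'rV[R]_n -> W) x v :
  differentiable f x ->
  'D_v f x = \sum_i v 0 i *: 'D_(delta_mx 0 i) f x.
Proof.
move=> df; rewrite {1}(row_sum_delta v) (deriveE _ df) linear_sum.
by apply: eq_bigr => i _; rewrite linearZ (deriveE _ df).
Qed.

Lemma differentiable_rV n m (f : 'rV[R]_n -> 'rV[R]_m) x :
  (forall j, differentiable (fun y => f y 0 j) x) -> differentiable f x.
Proof.
move=> df; have -> : f = \sum_j (fun y => f y 0 j *: delta_mx 0 j).
  by apply/funext => y; rewrite fct_sumE -row_sum_delta.
by apply: differentiable_sum => j; exact: differentiableZl.
Qed.

Lemma differentiable_rV_coord n m (f : 'rV[R]_n -> 'rV[R]_m) x i j :
  differentiable f x -> differentiable (fun y => f y i j) x.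
Proof.
move=> df; rewrite -[fun y => _]/((fun N : 'rV[R]_m => N i j) \o f).
by apply: differentiable_comp => //; exact: differentiable_coord.
Qed.

End Calculus.

(* Keeps unification from unfolding nested directional derivatives. *)
Local Opaque derive.

(** * Functions of class C^k *)

Section CkTheory.
Variable R : realType.

Lemma Ck_sub k n (W : normedModType R) (U V : set 'rV[R]_n)
    (f : 'rV[R]_n -> W) : V `<=` U -> Ck k U f -> Ck k V f.
Proof.
move=> VU; elim: k f => [|k IH] f /=; first by move=> cf x /VU; exact: cf.
by case=> df Df; split=> [x /VU|v]; [exact: df|exact: IH].
Qed.

Lemma CkS k n (W : normedModType R) (U : set 'rV[R]_n) (f : 'rV[R]_n -> W) :
  Ck k.+1 U f -> Ck k U f.
Proof.
elim: k f => [|k IH] f [df Df].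
  by move=> x Ux; exact/differentiable_continuous/df.
by split=> // v; exact: IH.
Qed.

(** Every clause of [Ck] is a condition at single points on iterated derivatives of the total
    function [f], so local pieces glue without any compatibility. *)
Lemma Ck_cover k n (W : normedModType R) (U : set 'rV[R]_n)
    (f : 'rV[R]_n -> W) :
  (forall x, U x -> exists2 V : set 'rV[R]_n, V x & Ck k V f) -> Ck k U f.
Proof.
elim: k f => [|k IH] f H.
  by move=> x Ux; have [V Vx cf] := H x Ux; exact: cf.
split=> [x /H[V Vx [df _]]|v]; first exact: df.
by apply: IH => x /H[V Vx [_ Df]]; exists V => //; exact: Df.
Qed.

Section OpenSet.
Variables (n : nat) (U : set 'rV[R]_n).
Hypothesis oU : open U.

Lemma near_open x : U x -> \forall y \near x, U y.
Proof. by move=> Ux; exact: open_nbhs_nbhs. Qed.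

(** Derivatives read nearby values, hence the role of an open [U]. Chart representatives, which have
    default values off the chart image, are compared through this lemma. *)
Lemma Ck_eq k (W : normedModType R) (f g : 'rV[R]_n -> W) :
  (forall x, U x -> f x = g x) -> Ck k U f -> Ck k U g.
Proof.
elim: k f g => [|k IH] f g fg /=.
  move=> cf x Ux.
  have nfg : {near x, f =1 g} by apply: filterS (near_open Ux) => y /fg.
  rewrite /prop_for /continuous_at -(fg _ Ux).
  exact: cvg_trans (near_eq_cvg nfg) (cf _ Ux).
have nfg x : U x -> {near x, f =1 g}.
  by move=> Ux; apply: filterS (near_open Ux) => y /fg.
case=> df Df; split=> [x Ux|v].
  exact: near_eq_differentiable (nfg _ Ux) (df _ Ux).
apply: IH (Df v) => x Ux; exact/near_eq_derive/nfg.
Qed.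

Lemma Ck_cst k (W : normedModType R) (w : W) : Ck k U (fun=> w).
Proof.
elim: k w => [|k IH] w; first by move=> x _; exact: cst_continuous.
split=> [x _|v]; first exact: differentiable_cst.
by apply: Ck_eq (IH 0) => x _; rewrite derive_cst.
Qed.

Lemma CkD k (W : normedModType R) (f g : 'rV[R]_n -> W) :
  Ck k U f -> Ck k U g -> Ck k U (fun x => f x + g x).
Proof.
elim: k f g => [|k IH] f g.
  by move=> cf cg x Ux; exact: (continuousD (cf x Ux) (cg x Ux)).
case=> df Df [dg Dg]; split=> [x Ux|v].
  by apply: differentiableD; [exact: df|exact: dg].
apply: Ck_eq (IH _ _ (Df v) (Dg v)) => x Ux.
by rewrite deriveD//; apply: diff_derivable; [exact: df|exact: dg].
Qed.

Lemma CkM k (f g : 'rV[R]_n -> R) :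
  Ck k U f -> Ck k U g -> Ck k U (fun x => f x * g x).
Proof.
elim: k f g => [|k IH] f g.
  by move=> cf cg x Ux; exact: (continuousM (cf x Ux) (cg x Ux)).
move=> Cf Cg; have [df Df] := Cf; have [dg Dg] := Cg; split=> [x Ux|v].
  by apply: differentiableM; [exact: df|exact: dg].
apply: Ck_eq (CkD (IH _ _ (CkS Cf) (Dg v)) (IH _ _ (CkS Cg) (Df v))) => x Ux.
by rewrite deriveM//; apply: diff_derivable; [exact: df|exact: dg].
Qed.

Lemma CkZ k (W : normedModType R) (f : 'rV[R]_n -> R) (w : W) :
  Ck k U f -> Ck k U (fun x => f x *: w).
Proof.
elim: k f => [|k IH] f.
  by move=> cf x Ux; exact: (continuousZr_tmp (cf x Ux)).
case=> df Df; split=> [x Ux|v].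
  by apply: differentiableZl; exact: df.
apply: Ck_eq (IH _ (Df v)) => x Ux.
have dfx := df x Ux.
by rewrite (deriveE v dfx) (deriveE v (differentiableZl w dfx)) diffZl.
Qed.

Lemma Ck_sum k (W : normedModType R) I (r : seq I) (P : pred I)
    (f : I -> 'rV[R]_n -> W) :
  (forall i, P i -> Ck k U (f i)) -> Ck k U (fun x => \sum_(i <- r | P i) f i x).
Proof.
move=> Cf; elim: r => [|i r IH].
  by apply: Ck_eq (Ck_cst k (0 : W)) => x _; rewrite big_nil.
have [Pi|Pi] := boolP (P i).
  by apply: Ck_eq (CkD (Cf i Pi) IH) => x _; rewrite big_cons Pi.
by apply: Ck_eq IH => x _; rewrite big_cons (negbTE Pi).
Qed.

Lemma Ck_prod k I (r : seq I) (P : pred I) (f : I -> 'rV[R]_n -> R) :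
  (forall i, P i -> Ck k U (f i)) ->
  Ck k U (fun x => \prod_(i <- r | P i) f i x).
Proof.
move=> Cf; elim: r => [|i r IH].
  by apply: Ck_eq (Ck_cst k (1 : R)) => x _; rewrite big_nil.
have [Pi|Pi] := boolP (P i).
  by apply: Ck_eq (CkM (Cf i Pi) IH) => x _; rewrite big_cons Pi.
by apply: Ck_eq IH => x _; rewrite big_cons (negbTE Pi).
Qed.

Lemma Ck_rV k m (f : 'rV[R]_n -> 'rV[R]_m) :
  (forall j, Ck k U (fun x => f x 0 j)) -> Ck k U f.
Proof.
move=> Cf; have := @Ck_sum k _ _ (enum 'I_m) xpredT
  (fun j x => f x 0 j *: (delta_mx 0 j : 'rV[R]_m)) (fun j _ => CkZ _ (Cf j)).
by apply: Ck_eq => x _; rewrite big_enum -row_sum_delta.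
Qed.

Lemma Ck_coord k m (f : 'rV[R]_n -> 'rV[R]_m) j :
  Ck k U f -> Ck k U (fun x => f x 0 j).
Proof.
elim: k f => [|k IH] f.
  move=> cf x Ux; apply: (@continuous_comp _ _ _ f (fun N : 'rV[R]_m => N 0 j)).
    exact: (cf x Ux).
  exact: coord_continuous.
case=> df Df; split=> [x Ux|v]; first exact/differentiable_rV_coord/df.
by apply: Ck_eq (IH _ (Df v)) => x Ux; rewrite derive_coord//; exact: df.
Qed.

Lemma Ck_linear k m (f : 'rV[R]_n -> 'rV[R]_m) : linear f -> continuous f ->
  Ck k U f.
Proof.
move=> lf cf; pose L : {linear _ -> _} :=
  HB.pack f (GRing.isLinear.Build _ _ _ _ _ lf).
case: k => [|k] /=; first by move=> x _; exact: cf.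
split=> [x _|v]; first by apply: (@linear_differentiable _ _ _ L).
apply: Ck_eq (Ck_cst k (f v)) => x _.
by rewrite -[f]/(L : _ -> _) derive_lin.
Qed.

(** Induction on [k] with [g] general: the chain rule writes the derivative as a sum of products of
    a coordinate of ['D_v f] and a partial derivative of [g] composed with [f], and the induction
    hypothesis covers the second factor. *)
Lemma Ck_comp k m (V : set 'rV[R]_m) (f : 'rV[R]_n -> 'rV[R]_m)
    (g : 'rV[R]_m -> R) :
  (forall x, U x -> V (f x)) -> Ck k U f -> Ck k V g -> Ck k U (g \o f).
Proof.
move=> UV; elim: k g => [|k IH] g.
  by move=> cf cg x Ux; exact: (continuous_comp (cf x Ux) (cg _ (UV x Ux))).
move=> Cf Cg; have [df Df] := Cf; have [dg Dg] := Cg; split=> [x Ux|v].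
  by apply: differentiable_comp; [exact: df|exact/dg/UV].
have := @Ck_sum k _ _ (enum 'I_m) xpredT
  (fun j x => ('D_v f x) 0 j * ('D_(delta_mx 0 j) g \o f) x)
  (fun j _ => CkM (Ck_coord j (Df v)) (IH _ (CkS Cf) (Dg _))).
apply: Ck_eq => x Ux; have dgfx := dg _ (UV x Ux).
rewrite big_enum (derive_comp_diff v (df x Ux) dgfx) (derive_sum_delta _ dgfx).
exact: eq_bigr.
Qed.

Lemma Ck_comp_rV k m p (V : set 'rV[R]_m) (f : 'rV[R]_n -> 'rV[R]_m)
    (g : 'rV[R]_m -> 'rV[R]_p) : open V ->
  (forall x, U x -> V (f x)) -> Ck k U f ->
  (forall j, Ck k V (fun y => g y 0 j)) -> Ck k U (g \o f).
Proof.
move=> oV UV Cf Cg; apply: Ck_rV => j.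
exact: Ck_comp UV Cf (Cg j).
Qed.

Lemma CkV k (f : 'rV[R]_n -> R) : (forall x, U x -> f x != 0) ->
  Ck k U f -> Ck k U (fun x => (f x)^-1).
Proof.
move=> f0; elim: k => [|k IH].
  by move=> cf x Ux; exact: (continuousV (f0 x Ux) (cf x Ux)).
move=> Cf; have [df Df] := Cf; split=> [x Ux|v].
  by apply: differentiableV; [exact: df|exact: f0].
have C1 := CkM (CkM (IH (CkS Cf)) (IH (CkS Cf)))
  (CkM (Ck_cst k (-1 : R)) (Df v)).
apply: Ck_eq C1 => x Ux; have dfx : derivable f x v := diff_derivable (df x Ux).
by rewrite (deriveV (f0 x Ux) dfx) mulN1r mulrN -mulNr -exprVn expr2.
Qed.

Lemma Ck_det k p (A : 'rV[R]_n -> 'M[R]_p) :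
  (forall i j, Ck k U (fun x => A x i j)) -> Ck k U (fun x => \det (A x)).
Proof.
move=> CA; rewrite /determinant; apply: Ck_sum => s _.
apply: CkM; first exact: Ck_cst.
by apply: Ck_prod => i _; exact: CA.
Qed.

(** Cramer's rule: an entry of the inverse is a cofactor divided by the determinant, both polynomial
    in the entries. *)
Lemma Ck_invmx k p (A : 'rV[R]_n -> 'M[R]_p) :
  (forall x, U x -> A x \in unitmx) ->
  (forall i j, Ck k U (fun x => A x i j)) ->
  forall i j, Ck k U (fun x => invmx (A x) i j).
Proof.
move=> uA CA i j.
have C1 : Ck k U (fun x => (\det (A x))^-1 * cofactor (A x) j i).
  apply: CkM; first apply: CkV.
  - by move=> x /uA; rewrite unitmxE unitfE.
  - exact: Ck_det.
  - rewrite /cofactor; apply: CkM; first exact: Ck_cst.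
    apply: Ck_det => a b.
    apply: Ck_eq (CA (lift j a) (lift i b)) => x _.
    by rewrite !mxE.
apply: Ck_eq C1 => x /uA ux.
by rewrite /invmx ux !mxE.
Qed.

End OpenSet.

End CkTheory.

(** * Symmetry of second derivatives *)

Section Schwarz.
Variable R : realType.

Lemma is_derive_line (V : normedModType R) (f : V -> R) (y v : V) (t : R) :
  differentiable f (y + t *: v) ->
  is_derive t 1 (fun s : R => f (y + s *: v)) ('D_v f (y + t *: v)).
Proof.
move=> df; apply: DeriveDef.
  have dl : differentiable (fun s : R => y + s *: v) t.
    by apply: differentiableD => //; exact: differentiableZl.
  exact: diff_derivable (differentiable_comp dl df).
apply: derive_line => h; congr f.
by rewrite scalerDl [h%:A]mulr1 addrCA.
Qed.

Variables (n : nat) (U : set 'rV[R]_n) (f : 'rV[R]_n -> R).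

Lemma mvt_line (g : 'rV[R]_n -> R) (y v : 'rV[R]_n) (d : R) : 0 < d ->
  (forall t, 0 <= t <= d -> differentiable g (y + t *: v)) ->
  exists2 c, 0 <= c <= d & g (y + d *: v) - g y = 'D_v g (y + c *: v) * d.
Proof.
move=> d0 dg.
have dl (t : R) : t \in `[0, d] ->
    is_derive t 1 (fun s : R => g (y + s *: v)) ('D_v g (y + t *: v)).
  by rewrite in_itv /= => td; apply: is_derive_line; exact: dg.
have dl' (t : R) : t \in `]0, d[ ->
    is_derive t 1 (fun s : R => g (y + s *: v)) ('D_v g (y + t *: v)).
  by move=> td; apply: dl; exact: subset_itv_oo_cc td.
have cl : {within `[0, d], continuous (fun s : R => g (y + s *: v))}.
  by apply: derivable_within_continuous => t td; have [] := dl t td.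
have [c cd] := MVT_segment (ltW d0) dl' cl.
rewrite scale0r addr0 subr0 => E; exists c => //.
Qed.

(** The mean value theorem is applied twice, along [u] to [y |-> f (y + d *: v) - f y] and then
    along [v] to ['D_u f]. The value of the left-hand side is symmetric in [u] and [v], which gives
    the symmetry of second derivatives in the limit. *)
Lemma second_difference (x u v : 'rV[R]_n) (d : R) : 0 < d -> Ck 2 U f ->
  (forall s t, 0 <= s <= d -> 0 <= t <= d -> U (x + s *: u + t *: v)) ->
  exists s t, [/\ 0 <= s <= d, 0 <= t <= d &
    f (x + d *: u + d *: v) - f (x + d *: u) - (f (x + d *: v) - f x) =
    'D_v ('D_u f) (x + s *: u + t *: v) * (d * d)].
Proof.
move=> d0 [df Df] Uxuv.
have d0d : 0 <= d <= d by rewrite lexx ltW.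
have d00 : 0 <= (0 : R) <= d by rewrite lexx ltW.
pose g y := f (y + d *: v) - f y.
have dfv y : differentiable f (y + d *: v) ->
    differentiable (fun z => f (z + d *: v)) y.
  have dl : differentiable (fun z => z + d *: v) y by exact: differentiableD.
  by move=> dfy; exact: (differentiable_comp dl dfy).
have Ux s : 0 <= s <= d -> U (x + s *: u).
  by move=> sd; have := Uxuv s 0 sd d00; rewrite scale0r addr0.
have dgs s : 0 <= s <= d -> differentiable g (x + s *: u).
  move=> sd; apply: differentiableB; last exact/df/Ux.
  by apply/dfv/df; exact: Uxuv.
have [s sd gE] := mvt_line d0 dgs.
have dDu t : 0 <= t <= d -> differentiable ('D_u f) (x + s *: u + t *: v).
  by move=> td; have [+ _] := Df u; apply; exact: Uxuv.
have [t td DE] := mvt_line d0 dDu.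
exists s, t; split => //.
have -> : f (x + d *: u + d *: v) - f (x + d *: u) - (f (x + d *: v) - f x) =
  g (x + d *: u) - g x by [].
rewrite gE mulrA -DE; congr (_ * _).
have dfs : derivable f (x + s *: u) u by apply/diff_derivable/df/Ux.
have dfsv : derivable (fun z => f (z + d *: v)) (x + s *: u) u.
  by apply/diff_derivable/dfv/df/Uxuv.
rewrite /g (deriveB dfsv dfs).
have E (h : R) : f (h *: u + (x + s *: u) + d *: v) =
    f (h *: u + (x + s *: u + d *: v)) by rewrite -addrA.
by rewrite (@derive_line _ _ _ _ (fun z => f (z + d *: v)) f _ _ _ _ E).
Qed.

(** The two mixed derivatives agree only at two different intermediate points, both arbitrarily
    close to [x]; continuity of each carries the equality to [x]. *)
Lemma continuous_meet (a b : 'rV[R]_n -> R) (x : 'rV[R]_n) :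
  {for x, continuous a} -> {for x, continuous b} ->
  (forall P : set 'rV[R]_n, (\forall y \near x, P y) ->
    exists p q, [/\ P p, P q & a p = b q]) -> a x = b x.
Proof.
move=> ca cb H; apply/eqP; rewrite -subr_eq0 -normr_le0.
apply/ler_addgt0Pr => e e0; rewrite add0r.
have e20 : 0 < e / 2 by rewrite divr_gt0.
move/cvgrPdist_lt: ca => /(_ _ e20) A.
move/cvgrPdist_lt: cb => /(_ _ e20) B.
have [p [q [[Ap _] [_ Bq] E]]] := H _ (filterI A B).
rewrite (splitr e) -(subrKA (a p)) (le_trans (ler_normD _ _))// lerD//.
  exact: ltW.
by rewrite E distrC ltW.
Qed.

Lemma schwarz (x u v : 'rV[R]_n) : open U -> Ck 2 U f -> U x ->
  'D_u ('D_v f) x = 'D_v ('D_u f) x.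
Proof.
move=> oU Cf Ux; have [_ Df] := Cf; have [_ Du] := Df u; have [_ Dv] := Df v.
apply: continuous_meet (Dv u x Ux) (Du v x Ux) _ => P nP.
have /nbhs_ballP[r /= r0 Br] : \forall y \near x, U y /\ P y.
  by apply: filterI nP; exact: near_open.
(* The summand 1 keeps the denominator positive when [u] and [v] vanish, and makes [d] times the sum
   of the norms strictly smaller than [r]. *)
pose d := r / (`|u| + `|v| + 1).
have k0 : 0 < `|u| + `|v| + 1 by rewrite ltr_wpDl// addr_ge0.
have d0 : 0 < d by rewrite divr_gt0.
have bd s t : 0 <= s <= d -> 0 <= t <= d -> ball x r (x + s *: u + t *: v).
  move=> /andP[s0 sd] /andP[t0 td].
  rewrite -ball_normE /ball_ /= -addrA opprD addNKr normrN.
  apply: (le_lt_trans (ler_normD _ _)); rewrite !normrZ !ger0_norm//.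
  apply: (@le_lt_trans _ _ (d * (`|u| + `|v|))).
    by rewrite mulrDr lerD// ler_wpM2r.
  rewrite [ltRHS](_ : r = d * (`|u| + `|v| + 1)) ?ltr_pM2l ?ltrDl//.
  by rewrite /d divfK// gt_eqF.
have Uuv s t : 0 <= s <= d -> 0 <= t <= d -> U (x + s *: u + t *: v).
  by move=> sd td; have [] := Br _ (bd _ _ sd td).
have Uvu s t : 0 <= s <= d -> 0 <= t <= d -> U (x + s *: v + t *: u).
  by move=> sd td; rewrite addrAC; exact: Uuv.
have [s [t [sd td E1]]] := second_difference d0 Cf Uuv.
have [s' [t' [sd' td' E2]]] := second_difference d0 Cf Uvu.
exists (x + s' *: v + t' *: u), (x + s *: u + t *: v); split.
- by rewrite addrAC; have [] := Br _ (bd _ _ td' sd').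
- by have [] := Br _ (bd _ _ sd td).
have E : f (x + d *: u + d *: v) - f (x + d *: u) - (f (x + d *: v) - f x) =
    f (x + d *: v + d *: u) - f (x + d *: v) - (f (x + d *: u) - f x).
  rewrite (addrAC x (d *: v)).
  by rewrite !opprB !addrA [LHS]addrAC [in RHS]addrAC -!addrA (addrCA (- _)).
have dd0 : d * d != 0 by rewrite mulf_neq0// gt_eqF.
exact: (mulIf dd0 (etrans (esym E2) (etrans (esym E) E1))).
Qed.

End Schwarz.

(** * Smooth bump functions *)

Section Bump.
Variable R : realType.

(** The classical flat function is [flat 0]. The power of [t^-1] makes the family stable under
    differentiation, so that one induction gives smoothness of all members. *)
Definition flat (m : nat) (t : R) : R :=
  if 0 < t then t^-1 ^+ m * expR (- t^-1) else 0.

Lemma flat_ge0 m t : 0 <= flat m t.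
Proof.
rewrite /flat; case: ifP => // t0.
by rewrite mulr_ge0 ?expR_ge0// exprn_ge0// invr_ge0 ltW.
Qed.

Lemma flat0 m t : t <= 0 -> flat m t = 0.
Proof. by move=> t0; rewrite /flat ltNge t0. Qed.

(** Follows from [exp s >= s^(m+2) / (m+2)!] at [s = 1/t]. A bound of order two is chosen so that
    the difference quotient at 0 tends to 0. *)
Lemma flat_bound m t : `|flat m t| <= (m.+2)`!%:R * `|t| ^+ 2.
Proof.
rewrite ger0_norm ?flat_ge0// /flat; case: ifPn => [t0|_]; last first.
  by rewrite mulr_ge0// exprn_ge0.
rewrite gtr0_norm// expRN.
have tV0 : 0 < t^-1 by rewrite invr_gt0.
have := @expR_ge1Dxn R t^-1 m.+1 (ltW tV0).
move=> le; have {le} : t^-1 ^+ m.+2 / (m.+2)`!%:R <= expR t^-1.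
  by apply: le_trans le; rewrite lerDr.
have F0 : 0 < (m.+2)`!%:R :> R by rewrite ltr0n fact_gt0.
rewrite ler_pdivrMr// => le.
rewrite ler_pdivrMr ?expR_gt0//.
have -> : t^-1 ^+ m = t ^+ 2 * t^-1 ^+ m.+2.
  by rewrite -[m.+2]add2n (exprD t^-1 2) mulrA -exprMn divff ?expr1n ?mul1r// gt_eqF.
have -> : (m.+2)`!%:R * t ^+ 2 * expR t^-1 = t ^+ 2 * (expR t^-1 * (m.+2)`!%:R).
  by ring.
by rewrite ler_wpM2l// sqr_ge0.
Qed.

Lemma is_derive_flat m (t : R) :
  is_derive t 1 (flat m) (flat m.+2 t - m%:R * flat m.+1 t).
Proof.
have [t0|t0|<-] := ltgtP 0 t.
- have nE : {near t, (fun s : R => s^-1 ^+ m * expR (- s^-1)) =1 flat m}.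
    have : \forall s \near t, 0 < s by exact: lt_nbhsr.
    by apply: filterS => s s0; rewrite /flat s0.
  apply: near_eq_is_derive nE _.
  have tn0 : t != 0 by rewrite gt_eqF.
  have dV : is_derive t 1 (fun s : R => s^-1) (- t ^- 2).
    by have := @is_deriveV R id t 1 1 tn0 (is_derive_id _ _); rewrite scaler1.
  have dN : is_derive t^-1 1 (expR \o -%R) (expR (- t^-1) * -1).
    by apply: is_derive1_comp; exact: is_deriveNid.
  have dX : is_derive t^-1 1 (@id R ^+ m) ((m%:R * t^-1 ^+ m.-1) *: 1).
    exact: is_deriveX.
  have idX (s : R) : (@id R ^+ m) s = s ^+ m.
    by elim: (m) => [|k IH]; rewrite ?expr0// !exprS -IH.
  have -> : (fun s : R => s^-1 ^+ m * expR (- s^-1)) =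
      (@id R ^+ m * (expR \o -%R)) \o (fun s => s^-1).
    by apply/funext => s /=; rewrite -idX.
  apply: is_derive_eq (is_derive1_comp (is_deriveM dX dN) dV) _.
  rewrite /flat t0 /GRing.scale /= idX.
  rewrite -[t ^- 2]exprVn.
  case: (m) => [|k]; rewrite /= ?mul0r ?mulr1 ?exprS; ring.
- have nE : {near t, cst 0 =1 flat m}.
    have : \forall s \near t, s < 0 by exact: lt_nbhsl.
    by apply: filterS => s s0; rewrite flat0 ?ltW.
  apply: near_eq_is_derive nE _.
  by rewrite !flat0 ?ltW// mulr0 subr0; exact: is_derive_cst.
have f0 k : flat k 0 = 0 by rewrite flat0.
rewrite !f0 mulr0 subr0.
have c0 : (fun h : R => h^-1 *: ((flat m \o shift 0) h%:A - flat m 0)) @ 0^'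
    --> (0 : R).
  have F0 : 0 < (m.+2)`!%:R :> R by rewrite ltr0n fact_gt0.
  apply/cvgrPdist_le => e e0; near=> h.
  have h0 : h != 0 by near: h; exact: nbhs_dnbhs_neq.
  rewrite sub0r normrN f0 subr0 /= addr0 normrZ normfV.
  rewrite ler_pdivrMl ?normr_gt0//.
  apply: (le_trans (flat_bound _ _)); rewrite [h%:A]mulr1.
  rewrite expr2 mulrA mulrC ler_pM2l ?normr_gt0// mulrC -ler_pdivlMr//.
  by near: h; apply: dnbhs0_le; rewrite divr_gt0.
apply: DeriveDef; first by apply/cvg_ex; exists 0.
exact: cvg_lim c0.
Unshelve. all: by end_near. Qed.

End Bump.

Section BumpFunction.
Variables (R : realType) (n : nat).

Lemma Ck_flat k m (U : set 'rV[R]_n) (g : 'rV[R]_n -> R) : open U ->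
  Ck k U g -> Ck k U (fun x => flat m (g x)).
Proof.
move=> oU; have df j t : differentiable (@flat R j) t.
  by apply/derivable1_diffP; have [] := is_derive_flat j t.
elim: k m => [|k IH] m.
  move=> cg x Ux; apply: (continuous_comp (cg x Ux)).
  exact/differentiable_continuous/df.
move=> Cg; have [dg Dg] := Cg; split=> [x Ux|v].
  exact: (differentiable_comp (dg x Ux) (df m _)).
have C1 : Ck k U (fun x =>
    (flat m.+2 (g x) + - m%:R * flat m.+1 (g x)) * 'D_v g x).
  apply: (CkM oU) (Dg v); apply: (CkD oU); first exact: IH (CkS Cg).
  by apply: (CkM oU); [exact: Ck_cst|exact: IH (CkS Cg)].
apply: (Ck_eq oU) C1 => x Ux.
rewrite (derive_comp_diff v (dg x Ux) (df m _)).
have [dm Dm] := is_derive_flat m (g x).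
rewrite (deriveE _ (df m _)) -[in RHS](mulr1 ('D_v g x)) linearZ.
rewrite -(deriveE _ (df m _)) Dm mulNr mulrC.
by [].
Qed.

Lemma Ck_coordinate k (U : set 'rV[R]_n) i : open U ->
  Ck k U (fun x : 'rV[R]_n => x 0 i).
Proof.
move=> oU; apply: (@Ck_coord _ _ _ oU _ _ id).
by apply: (Ck_linear oU) => // x; exact: cvg_id.
Qed.

(** The function is [flat 0] of [r^2] minus the squared Euclidean distance, normalized at [x0]: this
    square is polynomial, whereas the norm of row vectors is the maximum norm. The Euclidean ball of
    radius [r] lies in the closed ball of the maximum norm, which serves as [K]. *)
Lemma bump_exists (V : set 'rV[R]_n) (x0 : 'rV[R]_n) : open V -> V x0 ->
  exists (b : 'rV[R]_n -> R) (K : set 'rV[R]_n),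
    [/\ smooth_on setT b, b x0 = 1, compact K, K `<=` V &
      forall x, ~ K x -> b x = 0].
Proof.
move=> oV Vx0.
have /nbhs_ballP[e /= e0 eV] : nbhs x0 V by exact: open_nbhs_nbhs.
(* Half the radius, so that the closed ball of radius [r] stays in the open ball of radius [e]. *)
pose r := e / 2.
have r0 : 0 < r by rewrite divr_gt0.
pose q (x : 'rV[R]_n) := r ^+ 2 - \sum_i (x 0 i - x0 0 i) ^+ 2.
have qx0 : q x0 = r ^+ 2.
  by rewrite /q big1 ?subr0// => i _; rewrite subrr expr0n.
have b0 : flat 0 (r ^+ 2) != 0.
  by rewrite /flat exprn_gt0// expr0 mul1r gt_eqF// expR_gt0.
exists (fun x => (flat 0 (r ^+ 2))^-1 * flat 0 (q x)), (closed_ball x0 r); split.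
- move=> k; apply: (CkM openT); first exact: (Ck_cst openT).
  apply: (Ck_flat _ openT); apply: (CkD openT); first exact: (Ck_cst openT).
  have CN : Ck k setT (fun x : 'rV[R]_n =>
      (-1) * \sum_i (x 0 i - x0 0 i) ^+ 2).
    apply: (CkM openT); first exact: (Ck_cst openT).
    apply: (Ck_sum openT) => i _; apply: (CkM openT); apply: (CkD openT);
      by [exact: (Ck_coordinate _ _ openT)|exact: (Ck_cst openT)].
  by apply: (Ck_eq openT) CN => x _; rewrite mulN1r.
- by rewrite qx0 mulVf.
- apply: bounded_closed_compact; last exact: closed_ball_closed.
  exists (`|x0| + r); split; first by rewrite num_real.
  move=> M rM x; rewrite closed_ballE// /closed_ball_ /= => xr.
  apply: le_trans (ltW rM); rewrite -(subrK x0 x) addrC (le_trans (ler_normD _ _))//.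
  by rewrite lerD2l distrC.
- move=> x; rewrite closed_ballE// /closed_ball_ /= => xr; apply: eV.
  rewrite -ball_normE /ball_ /=; apply: le_lt_trans xr _.
  by rewrite /r ltr_pdivrMr// ltr_pMr// ltr1n.
- move=> x; rewrite closed_ballE// /closed_ball_ /= => xr.
  suff q0 : q x <= 0 by rewrite (flat0 _ q0) mulr0.
  rewrite /q subr_le0 leNgt; apply/negP => sr; apply: xr.
  rewrite [leLHS]/Num.Def.normr/= mx_normrE (bigmax_le _ (ltW r0))//= => -[i j] _.
  rewrite !mxE /= distrC (ord1 i) -(@ler_pXn2r _ 2)// ?nnegrE// ?(ltW r0)//.
  rewrite real_normK ?num_real//; apply: le_trans (ltW sr).
  by rewrite (bigD1 j)//= lerDl sumr_ge0// => i' _; exact: sqr_ge0.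
Qed.

End BumpFunction.

(** * Derivatives along a direction that varies with the point *)

Section MovingDerivative.
Variables (R : realType) (N n : nat).

(** Expanding [A z'] over the basis gives a sum of products of a coordinate of [A] and a fixed
    partial derivative of [g] at [X z']. The product rule yields one term for the motion of the base
    point and one for the motion of the direction. *)
Lemma derive_moving (U : set 'rV[R]_n) (g : 'rV[R]_n -> R)
    (A X : 'rV[R]_N -> 'rV[R]_n) (z v : 'rV[R]_N) :
  open U -> Ck 2 U g -> U (X z) -> differentiable A z -> differentiable X z ->
  differentiable (fun z' => 'D_(A z') g (X z')) z /\
  'D_v (fun z' => 'D_(A z') g (X z')) z =
  'D_('D_v X z) ('D_(A z) g) (X z) + 'D_('D_v A z) g (X z).
Proof.
move=> oU Cg UXz dA dX; have [dg Dg] := Cg.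
have dgi i : differentiable ('D_(delta_mx 0 i) g) (X z).
  by have [+ _] := Dg (delta_mx 0 i); apply.
have dAi i : differentiable (fun z' => A z' 0 i) z.
  exact: differentiable_rV_coord.
have dgXi i : differentiable ('D_(delta_mx 0 i) g \o X) z.
  exact: differentiable_comp.
pose h i : 'rV[R]_N -> R := (fun z' => A z' 0 i) * ('D_(delta_mx 0 i) g \o X).
have dh i : differentiable (h i) z by exact: differentiableM.
have nE : {near z, \sum_i h i =1 (fun z' => 'D_(A z') g (X z'))}.
  have nU : \forall z' \near z, U (X z').
    have cX := differentiable_continuous dX.
    by apply: (cX U); exact: near_open.
  apply: filterS nU => z' Uz'; rewrite fct_sumE (derive_sum_delta (A z') (dg _ Uz')).
  exact: eq_bigr.
have dS : differentiable (\sum_i h i) z by exact: differentiable_sum.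
split; first exact: near_eq_differentiable nE dS.
rewrite -(near_eq_derive v nE) derive_sum; last first.
  by move=> i; exact: diff_derivable.
have -> : 'D_('D_v X z) ('D_(A z) g) (X z) =
    \sum_i A z 0 i * 'D_('D_v X z) ('D_(delta_mx 0 i) g) (X z).
  pose k i : 'rV[R]_n -> R := A z 0 i *: ('D_(delta_mx 0 i) g).
  have kE : {near X z, \sum_i k i =1 'D_(A z) g}.
    apply: filterS (near_open oU UXz) => x Ux.
    by rewrite fct_sumE (derive_sum_delta (A z) (dg _ Ux)).
  rewrite -(near_eq_derive ('D_v X z) kE) derive_sum; last first.
    by move=> i; apply: diff_derivable; exact: differentiableZ.
  apply: eq_bigr => i _; rewrite deriveZ//; exact: diff_derivable.
rewrite (derive_sum_delta ('D_v A z) (dg _ UXz)) -big_split /=.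
apply: eq_bigr => i _.
rewrite /h deriveM; [|exact: diff_derivable|exact: diff_derivable].
rewrite (derive_comp_diff v dX (dgi i)); congr (_ + _).
by rewrite derive_coord// /GRing.scale /= mulrC.
Qed.

End MovingDerivative.

Section BlockDerivatives2.
Variables (R : realType) (n1 n2 : nat).

Lemma derive_lsubmx (W : normedModType R) (F : 'rV[R]_n1 -> W)
    (z v : 'rV[R]_(n1 + n2)) :
  'D_v (fun z' => F (lsubmx z')) z = 'D_(lsubmx v) F (lsubmx z).
Proof. by apply: derive_line => h; rewrite linearD linearZ. Qed.

Lemma derive_rsubmx (W : normedModType R) (F : 'rV[R]_n2 -> W)
    (z v : 'rV[R]_(n1 + n2)) :
  'D_v (fun z' => F (rsubmx z')) z = 'D_(rsubmx v) F (rsubmx z).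
Proof. by apply: derive_line => h; rewrite linearD linearZ. Qed.

Lemma row_mx_sum (a : 'rV[R]_n1) (b : 'rV[R]_n2) :
  row_mx a b = \sum_i a 0 i *: row_mx (delta_mx 0 i) 0 +
               \sum_i b 0 i *: row_mx 0 (delta_mx 0 i).
Proof.
rewrite -[RHS]hsubmxK !linearD !linear_sum /= {1}(row_sum_delta a)
  {1}(row_sum_delta b); congr row_mx.
  rewrite [X in _ + X]big1 ?addr0.
    by apply: eq_bigr => i _; rewrite linearZ /= row_mxKl.
  by move=> i _; rewrite linearZ /= row_mxKl scaler0.
rewrite [X in X + _]big1 ?add0r.
  by apply: eq_bigr => i _; rewrite linearZ /= row_mxKr.
by move=> i _; rewrite linearZ /= row_mxKr scaler0.
Qed.

Lemma derive_row_mx_sum (W : normedModType R) (f : 'rV[R]_(n1 + n2) -> W) z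
    (a : 'rV[R]_n1) (b : 'rV[R]_n2) : differentiable f z ->
  'D_(row_mx a b) f z =
  \sum_i a 0 i *: 'D_(row_mx (delta_mx 0 i) 0) f z +
  \sum_i b 0 i *: 'D_(row_mx 0 (delta_mx 0 i)) f z.
Proof.
move=> df; rewrite row_mx_sum (deriveE _ df) linearD !linear_sum.
by congr (_ + _); apply: eq_bigr => i _; rewrite linearZ (deriveE _ df).
Qed.

End BlockDerivatives2.

Section BlockDerivatives.
Variables (R : realType) (V : normedModType R) (n1 n2 : nat).

Lemma differentiable_row_mx (F : V -> 'rV[R]_n1) (G : V -> 'rV[R]_n2) z :
  differentiable F z -> differentiable G z ->
  differentiable (fun z' => row_mx (F z') (G z')) z.
Proof.
move=> dF dG.
have coordE p (H : V -> 'rV[R]_p) i : differentiable H z ->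
    differentiable (fun z' => H z' 0 i) z.
  move=> dH; exact: (differentiable_comp dH (differentiable_coord _ _ _)).
have -> : (fun z' => row_mx (F z') (G z')) =
    \sum_i (fun z' => F z' 0 i *: row_mx (delta_mx 0 i) 0) +
    \sum_i (fun z' => G z' 0 i *: row_mx 0 (delta_mx 0 i)).
  by apply/funext => z'; rewrite !fctE !fct_sumE; exact: row_mx_sum.
by apply: differentiableD; apply: differentiable_sum => i;
  apply: differentiableZl; exact: coordE.
Qed.

Lemma derive_row_mx (F : V -> 'rV[R]_n1) (G : V -> 'rV[R]_n2) z v :
  differentiable F z -> differentiable G z ->
  'D_v (fun z' => row_mx (F z') (G z')) z = row_mx ('D_v F z) ('D_v G z).
Proof.
move=> dF dG; have dFG := differentiable_row_mx dF dG.
rewrite derive_mx; last exact: diff_derivable.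
rewrite !derive_mx; [|exact: diff_derivable|exact: diff_derivable].
apply/matrixP => i j; rewrite !mxE.
by case: (splitP j) => k jk; rewrite !mxE; congr ('D_v _ z); apply/funext => z';
   rewrite !mxE; case: (splitP j) => k'; rewrite jk => /eqP;
   rewrite ?eqn_add2l => /eqP kk'; try (by congr (_ _ _ _); apply/val_inj);
   have := ltn_ord k; rewrite ?kk'; have := ltn_ord k'; rewrite -?kk'; lia.
Qed.

End BlockDerivatives.

(** * Sprays and the Euler-Lagrange equation *)

Section Spray.
Variables (R : realType) (n : nat) (L : 'rV[R]_(n + n) -> R).
Variable W : set 'rV[R]_(n + n).
Hypotheses (oW : open W) (sL : smooth_on W L).
Hypothesis gU : forall z, W z -> fund_tensor L z \in unitmx.

Lemma smooth_derive m (V : normedModType R) (U : set 'rV[R]_m)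
    (f : 'rV[R]_m -> V) v : smooth_on U f -> smooth_on U ('D_v f).
Proof. by move=> sf k; have [_] := sf k.+1; exact. Qed.

Lemma smooth_differentiable m (V : normedModType R) (U : set 'rV[R]_m)
    (f : 'rV[R]_m -> V) x : smooth_on U f -> U x -> differentiable f x.
Proof. by move=> sf Ux; have [+ _] := sf 1%N; exact. Qed.

Lemma smooth_schwarz m (U : set 'rV[R]_m) (f : 'rV[R]_m -> R) x u v :
  open U -> smooth_on U f -> U x -> 'D_u ('D_v f) x = 'D_v ('D_u f) x.
Proof. by move=> oU sf Ux; exact: schwarz oU (sf 2%N) Ux. Qed.

Lemma smooth_fund_tensor a b : smooth_on W (fun z => fund_tensor L z a b).
Proof.
move=> k; have C : Ck k W (fun z => 2^-1 * 'D_(e_y R a) ('D_(e_y R b) L) z).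
  apply: (CkM oW); first exact: Ck_cst.
  exact: (smooth_derive _ (smooth_derive _ sL)).
by apply: (Ck_eq oW) C => z _; rewrite mxE.
Qed.

Lemma Ck_rsubmx_coord k p q (U : set 'rV[R]_(p + q)) c : open U ->
  Ck k U (fun z : 'rV[R]_(p + q) => rsubmx z 0 c).
Proof.
move=> oU; apply: Ck_eq (Ck_coordinate k (rshift p c) oU) => // z _.
by rewrite mxE.
Qed.

Lemma Ck_lsubmx_coord k p q (U : set 'rV[R]_(p + q)) c : open U ->
  Ck k U (fun z : 'rV[R]_(p + q) => lsubmx z 0 c).
Proof.
move=> oU; apply: Ck_eq (Ck_coordinate k (lshift q c) oU) => // z _.
by rewrite mxE.
Qed.

Lemma smooth_spray a : smooth_on W (spray L a).
Proof.
move=> k; apply: (CkM oW); first exact: Ck_cst.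
apply: (Ck_sum oW) => b _; apply: (CkM oW).
  apply: (Ck_invmx oW gU) => i j; exact: smooth_fund_tensor.
have C1 : Ck k W (fun z => (\sum_c 'D_(e_y R b) ('D_(e_x R c) L) z * rsubmx z 0 c) +
   (-1) * 'D_(e_x R b) L z).
  apply: (CkD oW).
    apply: (Ck_sum oW) => c _; apply: (CkM oW).
      exact: (smooth_derive _ (smooth_derive _ sL)).
    exact: Ck_rsubmx_coord.
  apply: (CkM oW); first exact: Ck_cst.
  exact: (smooth_derive _ sL).
by apply: (Ck_eq oW) C1 => z _; rewrite mulN1r.
Qed.

Lemma fund_tensor_sym z a b : W z ->
  fund_tensor L z a b = fund_tensor L z b a.
Proof. by move=> Wz; rewrite !mxE (smooth_schwarz _ _ oW sL Wz). Qed.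

Definition sprayv z : 'rV[R]_n := \row_a spray L a z.

(** Multiplication by the fundamental tensor clears the inverse in the definition of [spray]; its
    symmetry turns the column convention of that definition into the row convention used here. *)
Lemma sprayv_fund_tensor z b : W z ->
  4 * (sprayv z *m fund_tensor L z) 0 b =
  \sum_c 'D_(e_y R b) ('D_(e_x R c) L) z * rsubmx z 0 c - 'D_(e_x R b) L z.
Proof.
move=> Wz; pose E : 'cV[R]_n := \col_b
  (\sum_c 'D_(e_y R b) ('D_(e_x R c) L) z * rsubmx z 0 c - 'D_(e_x R b) L z).
have gT : (fund_tensor L z)^T = fund_tensor L z.
  by apply/matrixP => i j; rewrite mxE; exact: fund_tensor_sym.
have -> : sprayv z = 4^-1 *: (invmx (fund_tensor L z) *m E)^T.
  apply/rowP => a; rewrite !mxE; congr (_ * _); apply: eq_bigr => c _.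
  by rewrite [in RHS]mxE.
rewrite -scalemxAl mxE mulrA divff ?mul1r ?pnatr_eq0//.
rewrite -{2}gT -trmx_mul mulmxA mulmxV ?mul1mx; last exact: gU.
by rewrite !mxE.
Qed.

(** The fibre derivatives of ['D_(e_y R b) L] are twice the entries of the fundamental tensor, so
    the Euler-Lagrange defect of the direction [(y, w)] is affine in [w] and vanishes at [w = -2 G].
    Existence and uniqueness of the solution both come from this identity. *)
Lemma euler_lagrangeE z w b : W z ->
  'D_(row_mx (rsubmx z) w) ('D_(e_y R b) L) z - 'D_(e_x R b) L z =
  2 * ((w + 2 *: sprayv z) *m fund_tensor L z) 0 b.
Proof.
move=> Wz; have dLb : differentiable ('D_(e_y R b) L) z.
  exact: (smooth_differentiable (smooth_derive _ sL) Wz).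
rewrite (derive_row_mx_sum _ _ dLb) mulmxDl mxE mulrDr.
rewrite -scalemxAl [in X in _ = _ + X]mxE mulrA.
have -> : 2 * 2 = 4 :> R by rewrite -natrM.
rewrite (sprayv_fund_tensor _ Wz) mxE mulr_sumr addrAC addrC.
congr (_ + (_ - _)).
  apply: eq_bigr => a _; rewrite mxE mulrCA; congr (_ * _).
  by rewrite mulrA divff ?mul1r ?pnatr_eq0.
apply: eq_bigr => c _.
rewrite (smooth_schwarz (e_y R b) (e_x R c) oW sL Wz) [RHS]mulrC.
by [].
Qed.

Lemma euler_lagrange z e : W z ->
  'D_(row_mx (rsubmx z) (- 2 *: sprayv z)) ('D_(row_mx 0 e) L) z =
  'D_(row_mx e 0) L z.
Proof.
move=> Wz; rewrite (smooth_schwarz _ _ oW sL Wz).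
have dLS v : differentiable ('D_v L) z.
  exact: (smooth_differentiable (smooth_derive _ sL) Wz).
rewrite (derive_row_mx_sum _ _ (dLS _)).
rewrite (derive_row_mx_sum _ _ (smooth_differentiable sL Wz)).
rewrite [X in X + _]big1; last by move=> i _; rewrite mxE scale0r.
rewrite [X in _ = _ + X]big1; last by move=> i _; rewrite mxE scale0r.
rewrite add0r addr0; apply: eq_bigr => b _; congr (_ *: _).
rewrite (smooth_schwarz _ _ oW sL Wz).
apply/eqP; rewrite -subr_eq0 (euler_lagrangeE _ _ Wz).
by rewrite scaleNr addNr mul0mx mxE mulr0.
Qed.

Lemma euler_lagrange_unique z w : W z ->
  (forall e, 'D_(row_mx (rsubmx z) w) ('D_(row_mx 0 e) L) z =
    'D_(row_mx e 0) L z) -> w = - 2 *: sprayv z.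
Proof.
move=> Wz H; apply/eqP; rewrite scaleNr -addr_eq0; apply/eqP.
apply: (row_free_inj (A := fund_tensor L z)); first by rewrite row_free_unit gU.
rewrite mul0mx; apply/rowP => b; rewrite [RHS]mxE.
have := euler_lagrangeE w b Wz; rewrite /e_y /e_x H subrr => /esym/eqP.
by rewrite mulf_eq0 pnatr_eq0 /= => /eqP.
Qed.

(** The horizontal lift of the base vector [xi] to the point [z] of the tangent bundle, computed in
    one chart. *)
Definition hvec z (xi : 'rV[R]_n) : 'rV[R]_(n + n) :=
  \sum_a xi 0 a *: delta_x L z a.

Lemma differentiable_sprayv z : W z -> differentiable sprayv z.
Proof.
move=> Wz; apply: differentiable_rV => j.
have -> : (fun y => sprayv y 0 j) = spray L j by apply/funext => y; rewrite mxE.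
exact: (smooth_differentiable (smooth_spray j) Wz).
Qed.

Lemma derive_sprayv_coord v z j : W z ->
  ('D_v sprayv z) 0 j = 'D_v (spray L j) z.
Proof.
move=> Wz; rewrite derive_coord; last exact: differentiable_sprayv.
suff -> : (fun y => sprayv y 0 j) = spray L j by [].
by apply/funext => y; rewrite mxE.
Qed.

(** [nonlin_conn] is the fibre derivative of the spray coefficients, so contracting it with [xi] is
    one directional derivative. In this form the lift can be transformed by differentiating the
    transformation law of the spray. *)
Lemma hvecE z xi : W z ->
  hvec z xi = row_mx xi (- 'D_(row_mx 0 xi) sprayv z).
Proof.
move=> Wz; rewrite (derive_row_mx_sum _ _ (differentiable_sprayv Wz)).
rewrite [X in X + _]big1 ?add0r; last by move=> i _; rewrite mxE scale0r.
rewrite /hvec row_mx_sum.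
rewrite -[LHS]hsubmxK -[RHS]hsubmxK !linearD !linear_sum /=.
congr row_mx.
  rewrite [X in _ = _ + X]big1 ?addr0.
    apply: eq_bigr => a _; rewrite !linearZ /= row_mxKl; congr (_ *: _).
    rewrite /delta_x linearB linear_sum /= row_mxKl big1 ?subr0// => b _.
    by rewrite linearZ /= row_mxKl scaler0.
  by move=> i _; rewrite linearZ /= row_mxKl scaler0.
rewrite [X in X + _]big1 ?add0r; last first.
  by move=> i _; rewrite linearZ /= row_mxKr scaler0.
under eq_bigr => a _.
  rewrite linearZ /= /delta_x linearB linear_sum /= row_mxKr sub0r scalerN.
  under eq_bigr do rewrite linearZ /= row_mxKr.
  over.
under [RHS]eq_bigr do rewrite linearZ /= row_mxKr.
rewrite sumrN (eq_bigr (fun a => \sum_b xi 0 a *: (nonlin_conn L z b a *: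
  delta_mx 0 b))); last by move=> a _; rewrite scaler_sumr.
rewrite exchange_big /= -sumrN; apply: eq_bigr => b _.
rewrite summxE -sumrN scaler_suml; apply: eq_bigr => a _.
rewrite scalerA -scaleNr; congr (_ *: _).
rewrite [nonlin_conn _ _ _ _]mxE [RHS]mxE [in RHS]mxE; congr (- (_ * _)).
exact: (esym (derive_sprayv_coord _ _ Wz)).
Qed.

End Spray.

Lemma derive_scalel (R : realType) (V : normedModType R) (f : R -> R) (b : V) t :
  differentiable f t -> 'D_1 (fun h => f h *: b) t = ('D_1 f t) *: b.
Proof.
move=> df; have dfb : differentiable (fun h => f h *: b) t.
  exact: differentiableZl.
by rewrite (deriveE _ dfb) (deriveE _ df) (diffZl b df).
Qed.

Lemma derive_rsubmx_lin (R : realType) n m (z v : 'rV[R]_(n + m)) :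
  'D_v (rsubmx : 'rV[R]_(n + m) -> 'rV[R]_m) z = rsubmx v.
Proof. by rewrite derive_lin//; exact: continuous_rsubmx. Qed.

Lemma derive_lsubmx_lin (R : realType) n m (z v : 'rV[R]_(n + m)) :
  'D_v (lsubmx : 'rV[R]_(n + m) -> 'rV[R]_n) z = lsubmx v.
Proof. by rewrite derive_lin//; exact: continuous_lsubmx. Qed.

Lemma derive_scaler (R : realType) (V W : normedModType R) (k : R)
    (f : V -> W) x v :
  derivable f x v -> 'D_v (fun y => k *: f y) x = k *: 'D_v f x.
Proof. by move=> df; rewrite -deriveZ. Qed.

Lemma near_derive_add (R : realType) (V W : normedModType R) (P Q S : V -> W) x v :
  derivable P x v -> derivable S x v ->
  (\forall y \near x, Q y + P y = S y) -> 'D_v Q x + 'D_v P x = 'D_v S x.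
Proof.
move=> dP dS nE.
have nE' : {near x, S - P =1 Q}.
  by apply: filterS nE => y; rewrite !fctE => <-; rewrite addrK.
have dQ : derivable Q x v by apply: near_eq_derivable nE' _; exact: derivableB.
by rewrite -deriveD//; exact: near_eq_derive.
Qed.

Definition coordf (R : realType) n m (f : 'rV[R]_n -> 'rV[R]_m) j x : R := f x 0 j.

(** * Tangent maps and their derivatives *)

Section TangentMap.
Variables (R : realType) (n m : nat) (U : set 'rV[R]_n) (phi : 'rV[R]_n -> 'rV[R]_m).
Hypotheses (oU : open U) (sphi : smooth_on U phi).

(** When [phi] is a transition map of the base, this is the transition map of the tangent bundle,
    see [tan_trans]. *)
Definition tangent_map (z : 'rV[R]_(n + n)) : 'rV[R]_(m + m) :=
  row_mx (phi (lsubmx z)) ('D_(rsubmx z) phi (lsubmx z)).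

Let phic j : 'rV[R]_n -> R := coordf phi j.

Lemma smooth_coord j : smooth_on U (phic j).
Proof. by move=> k; exact: Ck_coord (sphi k). Qed.

Lemma derive_smooth_coord v x j : U x -> ('D_v phi x) 0 j = 'D_v (phic j) x.
Proof. by move=> Ux; rewrite derive_coord//; exact: smooth_differentiable sphi Ux. Qed.

Lemma derive2_smooth_coord u v x j : U x ->
  ('D_u ('D_v phi) x) 0 j = 'D_u ('D_v (phic j)) x.
Proof.
move=> Ux; rewrite derive_coord; last first.
  exact: smooth_differentiable (smooth_derive v sphi) Ux.
apply: near_eq_derive; apply: filterS (near_open oU Ux) => y Uy.
exact: derive_smooth_coord.
Qed.

Lemma derive2_sym u v x : U x -> 'D_u ('D_v phi) x = 'D_v ('D_u phi) x.
Proof.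
move=> Ux; apply/rowP => j.
have E : 'D_u ('D_v (phic j)) x = 'D_v ('D_u (phic j)) x.
  exact: smooth_schwarz oU (smooth_coord j) Ux.
have E1 := derive2_smooth_coord u v j Ux.
have E2 := derive2_smooth_coord v u j Ux.
exact: etrans E1 (etrans E (esym E2)).
Qed.

Lemma derive_moving_tangent (A : 'rV[R]_(n + n) -> 'rV[R]_n) z v :
  U (lsubmx z) -> differentiable A z ->
  differentiable (fun y => 'D_(A y) phi (lsubmx y)) z /\
  'D_v (fun y => 'D_(A y) phi (lsubmx y)) z =
  'D_(lsubmx v) ('D_(A z) phi) (lsubmx z) + 'D_('D_v A z) phi (lsubmx z).
Proof.
move=> Uz dA.
have dl : differentiable (lsubmx : 'rV[R]_(n + n) -> _) z.
  exact: differentiable_lsubmx.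
have Dl : 'D_v (lsubmx : 'rV[R]_(n + n) -> _) z = lsubmx v.
  exact: derive_lsubmx_lin.
have M j := derive_moving v oU (smooth_coord j 2%N) Uz dA dl.
have nU : \forall y \near z, U (lsubmx y).
  by apply: (@continuous_lsubmx R 1 n n z U); exact: near_open.
have nE j : {near z, (fun y => 'D_(A y) (phic j) (lsubmx y)) =1
    (fun y => ('D_(A y) phi (lsubmx y)) 0 j)}.
  by apply: filterS nU => y Uy; rewrite (derive_smooth_coord _ j Uy).
have dD : differentiable (fun y => 'D_(A y) phi (lsubmx y)) z.
  apply: differentiable_rV => j.
  by apply: near_eq_differentiable (nE j) _; have [] := M j.
split=> //; apply/rowP => j; rewrite (derive_coord _ _ _ dD) [RHS]mxE.
have E1 := derive2_smooth_coord (lsubmx v) (A z) j Uz.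
have E2 := derive_smooth_coord ('D_v A z) j Uz.
have [_ Mj] := M j; rewrite Dl in Mj.
exact: etrans (esym (near_eq_derive v (nE j)))
  (etrans Mj (esym (f_equal2 +%R E1 E2))).
Qed.

Lemma derive_tangent_map z v : U (lsubmx z) ->
  differentiable tangent_map z /\
  'D_v tangent_map z = row_mx ('D_(lsubmx v) phi (lsubmx z))
    ('D_(lsubmx v) ('D_(rsubmx z) phi) (lsubmx z) +
     'D_(rsubmx v) phi (lsubmx z)).
Proof.
move=> Uz.
have dr : differentiable (rsubmx : 'rV[R]_(n + n) -> _) z.
  exact: differentiable_rsubmx.
have Dr : 'D_v (rsubmx : 'rV[R]_(n + n) -> _) z = rsubmx v.
  exact: derive_rsubmx_lin.
have [dG DG] := derive_moving_tangent v Uz dr.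
have dF : differentiable (fun y : 'rV[R]_(n + n) => phi (lsubmx y)) z.
  have dl : differentiable (lsubmx : 'rV[R]_(n + n) -> _) z.
    exact: differentiable_lsubmx.
  exact: (differentiable_comp dl (smooth_differentiable sphi Uz)).
split; first exact: differentiable_row_mx.
by rewrite derive_row_mx// DG Dr derive_lsubmx.
Qed.

Lemma derive_tangent_map_vertical z xi : U (lsubmx z) ->
  'D_(row_mx 0 xi) tangent_map z = row_mx 0 ('D_xi phi (lsubmx z)).
Proof.
move=> Uz; have [_ D] := derive_tangent_map (row_mx 0 xi) Uz.
by apply: etrans D _; rewrite row_mxKl row_mxKr !derive0 add0r.
Qed.

(** A vertical displacement keeps the base point, and there the second derivative of [phi] is a
    symmetric bilinear form [B]. Along the line the function is the polynomial
    [B q q + 2 h B xi q + h^2 B xi xi] in [h]. *)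
Lemma derive_quadratic z xi : U (lsubmx z) ->
  'D_(row_mx 0 xi) (fun y => 'D_(rsubmx y) ('D_(rsubmx y) phi) (lsubmx y)) z =
  2 *: 'D_xi ('D_(rsubmx z) phi) (lsubmx z).
Proof.
move=> Uz; set x := lsubmx z; set q := rsubmx z.
have dD w : differentiable ('D_w phi) x.
  exact: smooth_differentiable (smooth_derive w sphi) Uz.
(* The second derivative is hidden behind an abstract [B], so that rewriting sees only linearity in
   the first slot and symmetry. *)
have [B [BE Bl Bs]] : exists B : 'rV[R]_n -> 'rV[R]_n -> 'rV[R]_m,
    [/\ forall u w, 'D_u ('D_w phi) x = B u w,
    forall (h : R) u u' w, B (h *: u + u') w = h *: B u w + B u' w &
    forall u w, B u w = B w u].
  exists (fun u w => 'D_u ('D_w phi) x); split; first by move=> u w.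
    by move=> h u u' w; exact: deriveDl (dD w).
  by move=> u w; exact: derive2_sym Uz.
pose g (h : R) := B q q + h *: (2 *: B xi q) + h ^+ 2 *: B xi xi.
have E (h : R) : 'D_(rsubmx (h *: row_mx 0 xi + z))
    ('D_(rsubmx (h *: row_mx 0 xi + z)) phi) (lsubmx (h *: row_mx 0 xi + z)) =
    g (h *: 1 + 0).
  rewrite !linearD !linearZ /= row_mxKl row_mxKr scaler0 add0r -/x -/q BE.
  rewrite Bl (Bs xi) (Bs q) !Bl (Bs q xi) /g addr0 [h%:A]mulr1 expr2.
  rewrite scaler_nat mulr2n !scalerDr scalerA -addrA [RHS]addrC.
  by congr (_ + _); rewrite addrA addrC.
rewrite (derive_line E) BE.
have dl (b : 'rV[R]_m) : differentiable (fun h : R => h *: b) 0.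
  exact: differentiableZl.
have d2 : differentiable (fun h : R => h ^+ 2) 0.
  by apply/derivable1_diffP; exact: exprn_derivable.
have did : differentiable (fun h : R => h) (0 : R) by [].
have dq (b : 'rV[R]_m) : differentiable (fun h : R => h ^+ 2 *: b) 0.
  exact: differentiableZl.
have -> : g = cst (B q q) + (fun h : R => h *: (2 *: B xi q)) +
  (fun h : R => h ^+ 2 *: B xi xi) by [].
rewrite deriveD; last 2 first.
- by apply: derivableD => //; exact: diff_derivable.
- exact: diff_derivable.
rewrite deriveD //; last exact: diff_derivable.
rewrite derive_cst add0r.
have D2 : 'D_1 (fun h : R => h ^+ 2) (0 : R) = 0.
  by rewrite (exp_derive 2 (0 : R) 1) /= expr1 scaler0 scale0r.
have D1 : 'D_1 (fun h : R => h) (0 : R) = 1 by exact: derive_id.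
have E1 := derive_scalel (2 *: B xi q) did.
have E2 := derive_scalel (B xi xi) d2.
by rewrite D1 scale1r in E1; rewrite D2 scale0r in E2; rewrite E1 E2 addr0.
Qed.

End TangentMap.

(** * Change of charts for sprays and horizontal lifts *)

Section SprayTransform.
Variables (R : realType) (n : nat) (U : set 'rV[R]_n) (phi : 'rV[R]_n -> 'rV[R]_n).
Variables (L L' : 'rV[R]_(n + n) -> R) (W W' : set 'rV[R]_(n + n)).
Hypotheses (oU : open U) (sphi : smooth_on U phi).
Hypothesis surj_phi : forall (x v : 'rV[R]_n), U x ->
  exists u : 'rV[R]_n, 'D_u phi x = v.
Hypotheses (oW : open W) (sL : smooth_on W L).
Hypotheses (oW' : open W') (sL' : smooth_on W' L').
Hypothesis gU : forall z, W z -> fund_tensor L z \in unitmx.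
Hypothesis gU' : forall z, W' z -> fund_tensor L' z \in unitmx.
Let Phi := tangent_map phi.
Hypothesis WU : forall z, W z -> U (lsubmx z).
Hypothesis WW' : forall z, W z -> W' (Phi z).
Hypothesis LPhi : forall z, W z -> L z = L' (Phi z).

Let dL' z : W z -> differentiable L' (Phi z).
Proof. by move=> Wz; exact: smooth_differentiable sL' (WW' Wz). Qed.

Let dPhi z : W z -> differentiable Phi z.
Proof. by move=> Wz; have [] := derive_tangent_map oU sphi 0 (WU Wz). Qed.

Let DPhi z v : W z -> 'D_v Phi z = row_mx ('D_(lsubmx v) phi (lsubmx z))
    ('D_(lsubmx v) ('D_(rsubmx z) phi) (lsubmx z) +
     'D_(rsubmx v) phi (lsubmx z)).
Proof. by move=> Wz; have [] := derive_tangent_map oU sphi v (WU Wz). Qed.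

Let DL z v : W z -> 'D_v L z = 'D_('D_v Phi z) L' (Phi z).
Proof.
move=> Wz; rewrite -(derive_comp_diff v (dPhi Wz) (dL' Wz)).
by apply: near_eq_derive; apply: filterS (near_open oW Wz) => y /LPhi.
Qed.

Let DPhi_y z e : W z -> 'D_(row_mx 0 e) Phi z = row_mx 0 ('D_e phi (lsubmx z)).
Proof. by move=> Wz; exact: (derive_tangent_map_vertical oU sphi e (WU Wz)). Qed.

(** The identity ['D_(row_mx 0 e) L = 'D_(A y) L' (Phi y)] is differentiated along [v]. Since [A]
    moves with the base point, a term in the vertical direction ['D_y ('D_e phi)] appears. The
    right-hand side produces ['D_e ('D_y phi)] in the same place, and the two cancel by symmetry of
    second derivatives. *)
Lemma euler_lagrange_transform z w e : W z ->
  'D_(row_mx (rsubmx z) w) ('D_(row_mx 0 e) L) z = 'D_(row_mx e 0) L z ->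
  'D_('D_(row_mx (rsubmx z) w) Phi z)
    ('D_(row_mx 0 ('D_e phi (lsubmx z))) L') (Phi z) =
  'D_(row_mx ('D_e phi (lsubmx z)) 0) L' (Phi z).
Proof.
move=> Wz; set v := row_mx (rsubmx z) w.
pose A (y : 'rV[R]_(n + n)) : 'rV[R]_(n + n) := row_mx 0 ('D_e phi (lsubmx y)).
have dDe : differentiable (fun y : 'rV[R]_(n + n) => 'D_e phi (lsubmx y)) z.
  have dl : differentiable (lsubmx : 'rV[R]_(n + n) -> _) z.
    exact: differentiable_lsubmx.
  exact: (differentiable_comp dl
    (smooth_differentiable (smooth_derive e sphi) (WU Wz))).
have dcst0 : differentiable (fun _ : 'rV[R]_(n + n) => 0 : 'rV[R]_n) z.
  exact: differentiable_cst.
have dA : differentiable A z by exact: differentiable_row_mx.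
have [_ M] := derive_moving v oW' (sL' 2%N) (WW' Wz) dA (dPhi Wz).
have nE : {near z, 'D_(row_mx 0 e) L =1 (fun y => 'D_(A y) L' (Phi y))}.
  by apply: filterS (near_open oW Wz) => y Wy; rewrite (DL _ Wy) (DPhi_y _ Wy).
set e' := 'D_e phi (lsubmx z); set dd := 'D_(rsubmx z) ('D_e phi) (lsubmx z).
have DA : 'D_v A z = row_mx 0 dd.
  apply: etrans (derive_row_mx v dcst0 dDe) _.
  apply: (f_equal2 (fun a b => row_mx a b)); first exact: derive_cst.
  by apply: etrans (derive_lsubmx ('D_e phi) z v) _; rewrite row_mxKl.
have H0 := etrans (near_eq_derive v nE) (etrans M (congr1
  (fun t => 'D_('D_v Phi z) ('D_(A z) L') (Phi z) + 'D_t L' (Phi z)) DA)).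
have H1 : 'D_(row_mx e 0) L z = 'D_(row_mx e' dd) L' (Phi z).
  rewrite (DL _ Wz) (DPhi _ Wz) row_mxKl row_mxKr derive0 addr0.
  by rewrite (derive2_sym oU sphi e (rsubmx z) (WU Wz)).
have H2 : 'D_(row_mx e' dd) L' (Phi z) =
    'D_(row_mx e' 0) L' (Phi z) + 'D_(row_mx 0 dd) L' (Phi z).
  have := deriveDl 1 (row_mx e' 0) (row_mx 0 dd) (dL' Wz).
  by rewrite !scale1r add_row_mx addr0 add0r.
move=> H.
exact: (addIr _ (etrans (esym H0) (etrans H (etrans H1 H2)))).
Qed.

(** The left-hand side is the fibre part of the image of [(y, -2 G)] under the derivative of [Phi].
    That image satisfies the Euler-Lagrange equation of [L'], for all directions because the
    derivative of [phi] is surjective, so uniqueness identifies it. *)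
Lemma sprayv_transform z : W z ->
  'D_(rsubmx z) ('D_(rsubmx z) phi) (lsubmx z) +
  'D_(- 2 *: sprayv L z) phi (lsubmx z) = - 2 *: sprayv L' (Phi z).
Proof.
move=> Wz; apply: (euler_lagrange_unique oW' sL' gU' (WW' Wz)) => e.
have [u <-] := surj_phi e (WU Wz).
rewrite /Phi /tangent_map row_mxKr -/(tangent_map phi z) -/Phi.
have E := DPhi (row_mx (rsubmx z) (- 2 *: sprayv L z)) Wz.
rewrite row_mxKl row_mxKr in E.
apply: etrans (congr1 (fun t => 'D_t ('D_(row_mx 0 ('D_u phi (lsubmx z))) L')
  (Phi z)) (esym E)) _.
exact: euler_lagrange_transform Wz (euler_lagrange oW sL gU u Wz).
Qed.

(** Fibre derivative of the transformation law of a spray. The factor 2 comes from the term that is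
    quadratic in [y]. *)
Lemma derive_spray_relation (S S' : 'rV[R]_(n + n) -> 'rV[R]_n) z xi :
  U (lsubmx z) -> differentiable S z -> differentiable S' (Phi z) ->
  (\forall y \near z, 'D_(rsubmx y) ('D_(rsubmx y) phi) (lsubmx y) +
    'D_(S y) phi (lsubmx y) = S' (Phi y)) ->
  2 *: 'D_xi ('D_(rsubmx z) phi) (lsubmx z) +
    'D_('D_(row_mx 0 xi) S z) phi (lsubmx z) =
  'D_(row_mx 0 ('D_xi phi (lsubmx z))) S' (Phi z).
Proof.
move=> Uz dS dS' nE; set v := row_mx 0 xi.
pose Q (y : 'rV[R]_(n + n)) := 'D_(rsubmx y) ('D_(rsubmx y) phi) (lsubmx y).
pose P (y : 'rV[R]_(n + n)) := 'D_(S y) phi (lsubmx y).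
have [dPhiz _] := derive_tangent_map oU sphi v Uz.
have DPhiv := derive_tangent_map_vertical oU sphi xi Uz.
have [dP DP] := derive_moving_tangent oU sphi v Uz dS.
have {}DP : 'D_v P z = 'D_('D_v S z) phi (lsubmx z).
  by apply: etrans DP _; rewrite {1}/v row_mxKl derive0 add0r.
have dS'P : differentiable (S' \o Phi) z by exact: differentiable_comp.
have DS' := etrans (derive_comp_diff v dPhiz dS')
  (congr1 (fun t => 'D_t S' (Phi z)) DPhiv).
have dvP : derivable P z v by exact: diff_derivable.
have dvS : derivable (S' \o Phi) z v by exact: diff_derivable.
have DQ : 'D_v Q z = 2 *: 'D_xi ('D_(rsubmx z) phi) (lsubmx z).
  exact: (derive_quadratic oU sphi xi Uz).
have E := near_derive_add dvP dvS nE.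
exact: etrans (f_equal2 +%R (esym DQ) (esym DP)) (etrans E DS').
Qed.

(** With [S = -2 G] every term of the differentiated spray law carries a factor 2 up to sign.
    Cancelling it leaves precisely the fibre part of the derivative of [Phi] on [hvec]. *)
Lemma hvec_transform z xi : W z ->
  'D_(hvec L z xi) Phi z = hvec L' (Phi z) ('D_xi phi (lsubmx z)).
Proof.
move=> Wz; have Uz := WU Wz.
have dG := differentiable_sprayv oW sL gU Wz.
have dG' := differentiable_sprayv oW' sL' gU' (WW' Wz).
have nE : \forall y \near z, 'D_(rsubmx y) ('D_(rsubmx y) phi) (lsubmx y) +
    'D_(- 2 *: sprayv L y) phi (lsubmx y) = - 2 *: sprayv L' (Phi y).
  by apply: filterS (near_open oW Wz) => y Wy; exact: sprayv_transform.
have dG2 : differentiable (fun y => - 2 *: sprayv L y) z.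
  exact: differentiableZ.
have dG2' : differentiable (fun y => - 2 *: sprayv L' y) (Phi z).
  exact: differentiableZ.
have := derive_spray_relation xi Uz dG2 dG2' nE.
rewrite !derive_scaler; last 2 first.
- exact: diff_derivable.
- exact: diff_derivable.
have dphi := smooth_differentiable sphi Uz.
have Dlin (c : R) w : 'D_(c *: w) phi (lsubmx z) = c *: 'D_w phi (lsubmx z).
  by have := deriveDl c w 0 dphi; rewrite derive0 !addr0.
rewrite Dlin => E.
rewrite (hvecE oW sL gU _ Wz) (hvecE oW' sL' gU' _ (WW' Wz)).
rewrite DPhi// row_mxKl row_mxKr; congr row_mx.
have Dopp w : 'D_(- w) phi (lsubmx z) = - 'D_w phi (lsubmx z).
  by rewrite -scaleN1r Dlin scaleN1r.
rewrite Dopp; apply: (@scalerI _ _ (2 : R)); first by rewrite pnatr_eq0.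
by rewrite scalerDr !scalerN -scaleNr E scaleNr.
Qed.

End SprayTransform.

(** * Atlases and tangent bundles *)

Section Atlas.
Variables (R : realType) (T : choiceType) (n : nat).

Definition chart_injective (M : charted R T n) := forall (c : cidx M) p q,
  cdom c p -> cdom c q -> cmap c p = cmap c q -> p = q.

(** What remains of a smooth manifold once the topology of [T] is forgotten: only images of overlaps
    are required to be open. Products can then be treated in coordinates alone. *)
Record atlas (M : charted R T n) : Prop := Atlas {
  atlas_inj : chart_injective M;
  atlas_open : forall c c' : cidx M, open (cmap c @` (cdom c `&` cdom c'));
  atlas_dom : forall p, cdom (chart_at M p) p;
  atlas_smooth : forall c c' : cidx M,
    smooth_on (cmap c @` (cdom c `&` cdom c')) (crep c (cmap c')) }.

Arguments atlas_open [M] _ c c'.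
Arguments atlas_smooth [M] _ c c'.

Section Rep.
Variable M : charted R T n.
Hypothesis injM : chart_injective M.

Lemma crepE (W : normedModType R) (c : cidx M) (u : T -> W) p : cdom c p ->
  crep c u (cmap c p) = u p.
Proof.
move=> cp; rewrite /crep; case: xgetP => [y _ [q [/= cq qp] <-]|H].
  by rewrite (injM cq cp qp).
by case: (H (u p)); exists p.
Qed.

Lemma crep_out (W : normedModType R) (c : cidx M) (u : T -> W) z :
  ~ cimg c z -> crep c u z = 0.
Proof.
move=> cz; rewrite /crep; case: xgetP => // y _ [q [/= cq qz] _].
by case: cz; exists q.
Qed.

End Rep.

Variable M : charted R T n.
Hypothesis aM : atlas M.
Let injM := atlas_inj aM.

Lemma open_cimg (c : cidx M) : open (cimg c).
Proof. by have := atlas_open aM c c; rewrite setIid. Qed.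

Arguments open_cimg : clear implicits.

(** Change of components of a tangent vector at [p] from chart [c] to chart [c']. When [c] is the
    preferred chart at [p] it is convertible to [tmap M (cmap c') p], a fact used silently in
    several proofs. *)
Definition dtrans (c c' : cidx M) (p : T) (v : 'rV[R]_n) : 'rV[R]_n :=
  'D_v (crep c (cmap c')) (cmap c p).

Lemma near_overlap (c c' : cidx M) p : cdom c p -> cdom c' p ->
  \forall z \near cmap c p, (cmap c @` (cdom c `&` cdom c')) z.
Proof. by move=> cp cp'; apply: near_open; [exact: atlas_open|exists p]. Qed.

Lemma differentiable_trans (c c' : cidx M) p : cdom c p -> cdom c' p ->
  differentiable (crep c (cmap c')) (cmap c p).
Proof.
move=> cp cp'; apply: smooth_differentiable (atlas_smooth aM c c') _.
by exists p.
Qed.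

Lemma derive_crep_trans (W : normedModType R) (u : T -> W) (c c' : cidx M) p v :
  cdom c p -> cdom c' p -> differentiable (crep c' u) (cmap c' p) ->
  'D_v (crep c u) (cmap c p) = 'D_(dtrans c c' p v) (crep c' u) (cmap c' p).
Proof.
move=> cp cp' du; have E := crepE injM (cmap c') cp.
have du' : differentiable (crep c' u) (crep c (cmap c') (cmap c p)).
  by rewrite E.
have := derive_comp_diff v (differentiable_trans cp cp') du'.
rewrite E => <-; apply: near_eq_derive.
apply: filterS (near_overlap cp cp') => _ [q [cq cq'] <-] /=.
by rewrite !crepE.
Qed.

Lemma dtrans_id (c : cidx M) p v : cdom c p -> dtrans c c p v = v.
Proof.
move=> cp; rewrite /dtrans.
have nE : {near cmap c p, crep c (cmap c) =1 id}.
  have cz : cimg c (cmap c p) by exists p.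
  have N := near_open (open_cimg c) cz.
  by apply: filterS N => _ [q cq <-]; rewrite crepE.
by rewrite (near_eq_derive v nE) derive_id.
Qed.

Lemma dtrans_comp (c c' c'' : cidx M) p v : cdom c p -> cdom c' p -> cdom c'' p ->
  dtrans c' c'' p (dtrans c c' p v) = dtrans c c'' p v.
Proof.
move=> cp cp' cp''; rewrite [RHS](derive_crep_trans v cp cp')//.
exact: differentiable_trans.
Qed.

Lemma dtransK (c c' : cidx M) p v : cdom c p -> cdom c' p ->
  dtrans c' c p (dtrans c c' p v) = v.
Proof. by move=> cp cp'; rewrite dtrans_comp// dtrans_id. Qed.

Lemma dtransP (c c' : cidx M) p (a : R) u v : cdom c p -> cdom c' p ->
  dtrans c c' p (a *: u + v) = a *: dtrans c c' p u + dtrans c c' p v.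
Proof. by move=> cp cp'; exact: deriveDl (differentiable_trans cp cp'). Qed.

Lemma dtrans0 (c c' : cidx M) p : dtrans c c' p 0 = 0.
Proof. exact: derive0. Qed.

Lemma dtransZ (c c' : cidx M) p (a : R) u : cdom c p -> cdom c' p ->
  dtrans c c' p (a *: u) = a *: dtrans c c' p u.
Proof.
move=> cp cp'; have := dtransP a u 0 cp cp'.
by rewrite dtrans0 !addr0.
Qed.

End Atlas.
Arguments open_cimg {R T n M} _ c.
Arguments atlas_open [R T n M] _ c c'.
Arguments atlas_smooth [R T n M] _ c c'.

(** * Products of atlases *)

Section ProductAtlas.
Variables (R : realType) (T1 T2 : choiceType) (n1 n2 : nat).
Variables (M1 : charted R T1 n1) (M2 : charted R T2 n2).
Hypotheses (a1 : atlas M1) (a2 : atlas M2).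
Let M := prod_charted M1 M2.

Lemma prod_overlap (c c' : cidx M) : cmap c @` (cdom c `&` cdom c') =
  [set z | (cmap c.1 @` (cdom c.1 `&` cdom c'.1)) (lsubmx z) /\
           (cmap c.2 @` (cdom c.2 `&` cdom c'.2)) (rsubmx z)].
Proof.
apply/seteqP; split=> z /=.
  move=> [[p1 p2] [[/= h1 h2] [/= h1' h2']] <-]; rewrite row_mxKl row_mxKr.
  by split; [exists p1|exists p2].
move=> [[p1 [h1 h1'] E1] [p2 [h2 h2'] E2]]; exists (p1, p2) => //=.
by rewrite E1 E2 hsubmxK.
Qed.

Lemma prod_chart_injective : chart_injective M.
Proof.
move=> c [p1 p2] [q1 q2] [/= h1 h2] [/= h1' h2'] /eq_row_mx[E1 E2].
by rewrite (atlas_inj a1 h1 h1' E1) (atlas_inj a2 h2 h2' E2).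
Qed.

(** Off the image of the product chart the representative is 0 as a whole, although one of the two
    components may still lie in the image of its own chart; hence the case distinction. *)
Lemma prod_crep (c : cidx M) (u1 : T1 -> 'rV[R]_n1) (u2 : T2 -> 'rV[R]_n2) z :
  crep (M := M) c (fun p => row_mx (u1 p.1) (u2 p.2)) z =
    if `[< cimg c z >] then
    row_mx (crep c.1 u1 (lsubmx z)) (crep c.2 u2 (rsubmx z)) else 0.
Proof.
case: asboolP => [[[p1 p2] [/= h1 h2] <-]|]; last exact: crep_out.
have hp : cdom c (p1, p2) by split.
rewrite (crepE prod_chart_injective _ hp) row_mxKl row_mxKr.
by rewrite (crepE (atlas_inj a1) _ h1) (crepE (atlas_inj a2) _ h2).
Qed.

Lemma open_block (A1 : set 'rV[R]_n1) (A2 : set 'rV[R]_n2) :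
  open A1 -> open A2 ->
  open [set z : 'rV[R]_(n1 + n2) | A1 (lsubmx z) /\ A2 (rsubmx z)].
Proof.
move=> o1 o2.
have -> : [set z : 'rV[R]_(n1 + n2) | A1 (lsubmx z) /\ A2 (rsubmx z)] =
  lsubmx @^-1` A1 `&` rsubmx @^-1` A2 by [].
apply: openI; apply: open_comp => // z _.
  exact: continuous_lsubmx.
exact: continuous_rsubmx.
Qed.

Lemma Ck_row_mx k m1 m2 N (U : set 'rV[R]_N) (f1 : 'rV[R]_N -> 'rV[R]_m1)
    (f2 : 'rV[R]_N -> 'rV[R]_m2) : open U ->
  Ck k U f1 -> Ck k U f2 -> Ck k U (fun x => row_mx (f1 x) (f2 x)).
Proof.
move=> oU C1 C2; apply: (Ck_rV oU) => j.
case: (split_ordP j) => i ->.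
  by apply: (Ck_eq oU) (Ck_coord oU i C1) => x _; rewrite row_mxEl.
by apply: (Ck_eq oU) (Ck_coord oU i C2) => x _; rewrite row_mxEr.
Qed.

Lemma Ck_lsubmx k (U : set 'rV[R]_(n1 + n2)) : open U ->
  Ck k U (lsubmx : 'rV[R]_(n1 + n2) -> _).
Proof. by move=> oU; apply: (Ck_rV oU) => j; exact: Ck_lsubmx_coord. Qed.

Lemma Ck_rsubmx k (U : set 'rV[R]_(n1 + n2)) : open U ->
  Ck k U (rsubmx : 'rV[R]_(n1 + n2) -> _).
Proof. by move=> oU; apply: (Ck_rV oU) => j; exact: Ck_rsubmx_coord. Qed.

Lemma Ck_comp_lsubmx k m (A1 : set 'rV[R]_n1) (U : set 'rV[R]_(n1 + n2))
    (f : 'rV[R]_n1 -> 'rV[R]_m) : open A1 -> open U ->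
  (forall z, U z -> A1 (lsubmx z)) -> Ck k A1 f ->
  Ck k U (fun z => f (lsubmx z)).
Proof.
move=> oA oU UA Cf; apply: (Ck_comp_rV oU oA UA (Ck_lsubmx _ oU)) => j.
exact: Ck_coord.
Qed.

Lemma Ck_comp_rsubmx k m (A2 : set 'rV[R]_n2) (U : set 'rV[R]_(n1 + n2))
    (f : 'rV[R]_n2 -> 'rV[R]_m) : open A2 -> open U ->
  (forall z, U z -> A2 (rsubmx z)) -> Ck k A2 f ->
  Ck k U (fun z => f (rsubmx z)).
Proof.
move=> oA oU UA Cf; apply: (Ck_comp_rV oU oA UA (Ck_rsubmx _ oU)) => j.
exact: Ck_coord.
Qed.

Lemma smooth_prod_crep (c : cidx M) (u1 : T1 -> 'rV[R]_n1)
    (u2 : T2 -> 'rV[R]_n2) (A1 : set 'rV[R]_n1) (A2 : set 'rV[R]_n2) :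
  open A1 -> open A2 -> A1 `<=` cimg c.1 -> A2 `<=` cimg c.2 ->
  smooth_on A1 (crep c.1 u1) -> smooth_on A2 (crep c.2 u2) ->
  smooth_on [set z | A1 (lsubmx z) /\ A2 (rsubmx z)]
    (crep (M := M) c (fun p => row_mx (u1 p.1) (u2 p.2))).
Proof.
move=> o1 o2 s1 s2 C1 C2 k; have oA := open_block o1 o2.
have C : Ck k [set z : 'rV[R]_(n1 + n2) | A1 (lsubmx z) /\ A2 (rsubmx z)]
    (fun z => row_mx (crep c.1 u1 (lsubmx z)) (crep c.2 u2 (rsubmx z))).
  apply: (Ck_row_mx oA).
    by apply: (Ck_comp_lsubmx o1 oA _ (C1 k)) => z [].
  by apply: (Ck_comp_rsubmx o2 oA _ (C2 k)) => z [].
apply: (Ck_eq oA) C => z [/s1[p1 h1 E1] /s2[p2 h2 E2]].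
rewrite prod_crep; case: asboolP => // -[]; exists (p1, p2) => //=.
by rewrite E1 E2 hsubmxK.
Qed.

Lemma prod_atlas : atlas M.
Proof.
split.
- exact: prod_chart_injective.
- move=> c c'; rewrite prod_overlap; apply: open_block; exact: atlas_open.
- by move=> [p1 p2]; split; exact: atlas_dom.
- move=> c c'; rewrite prod_overlap.
  apply: (smooth_prod_crep (u1 := cmap c'.1) (u2 := cmap c'.2)).
  + exact: atlas_open.
  + exact: atlas_open.
  + by move=> _ [p [h _] <-]; exists p.
  + by move=> _ [p [h _] <-]; exists p.
  + exact: atlas_smooth.
  + exact: atlas_smooth.
Qed.

Lemma prod_dtrans (c c' : cidx M) p v : cdom c p -> cdom c' p ->
  dtrans c c' p v = row_mx (dtrans c.1 c'.1 p.1 (lsubmx v))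
                           (dtrans c.2 c'.2 p.2 (rsubmx v)).
Proof.
case: p => p1 p2 [/= h1 h2] [/= h1' h2'].
have nE : {near cmap c (p1, p2), (fun z => row_mx (crep c.1 (cmap c'.1) (lsubmx z))
    (crep c.2 (cmap c'.2) (rsubmx z))) =1 crep c (cmap c')}.
  have hp : cdom c (p1, p2) by split.
  have hp' : cdom c' (p1, p2) by split.
  have := near_overlap prod_atlas hp hp'.
  apply: filterS => _ [q [hq _] <-]; rewrite (prod_crep c (cmap c'.1)).
  by case: asboolP => // -[]; exists q.
rewrite /dtrans -(near_eq_derive v nE).
have d1 : differentiable (crep c.1 (cmap c'.1)) (lsubmx (cmap c (p1, p2))).
  by rewrite row_mxKl; exact: differentiable_trans.
have d2 : differentiable (crep c.2 (cmap c'.2)) (rsubmx (cmap c (p1, p2))).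
  by rewrite row_mxKr; exact: differentiable_trans.
rewrite derive_row_mx; last 2 first.
- exact: (differentiable_comp (differentiable_lsubmx _) d1).
- exact: (differentiable_comp (differentiable_rsubmx _) d2).
by rewrite derive_lsubmx derive_rsubmx row_mxKl row_mxKr.
Qed.

End ProductAtlas.

(* [P] constrains only the fibre component, through [P0]: this covers the slit
   bundle of a manifold and the product of two slit bundles. *)
Section TangentBundle.
Variables (R : realType) (T : choiceType) (n : nat) (M : charted R T n).
Variables (P : pred (T * 'rV[R]_n)) (P0 : pred 'rV[R]_n).
Hypothesis aM : atlas M.
Hypothesis PE : forall v, P v = P0 v.2.
Hypothesis oP0 : open [set y | P0 y].
Hypothesis P0_dtrans : forall (c c' : cidx M) p v, cdom c p -> cdom c' p ->
  P0 (dtrans c c' p v) = P0 v.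

Let S := submanifold (tbundle M) P.
Let injM := atlas_inj aM.

Lemma tan_cmapE (c : cidx M) (w : {v | P v}) :
  cmap (c : cidx S) w = row_mx (cmap c (val w).1)
    (dtrans (chart_at M (val w).1) c (val w).1 (val w).2).
Proof. by []. Qed.

(** Vectors are stored by their components in the preferred chart, so [y] is carried back there by a
    transition; invariance of [P0] keeps the result in [P]. *)
Lemma tan_point (c : cidx M) p y : cdom c p -> P0 y ->
  exists w : {v | P v}, (val w).1 = p /\
    cmap (c : cidx S) w = row_mx (cmap c p) y.
Proof.
move=> cp Py; have c0p := atlas_dom aM p.
have Pv : P (p, dtrans c (chart_at M p) p y) by rewrite PE /= P0_dtrans.
exists (exist (fun v => P v) _ Pv); split => //.
by rewrite tan_cmapE /= (dtransK aM).
Qed.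

Lemma tan_P0 (c : cidx M) (w : {v | P v}) : cdom c (val w).1 ->
  P0 (dtrans (chart_at M (val w).1) c (val w).1 (val w).2).
Proof.
move=> cw; rewrite P0_dtrans//; last exact: atlas_dom.
by have := valP w; rewrite PE.
Qed.

Lemma tan_cimg (c : cidx M) : cimg (c : cidx S) =
  [set z | cimg (c : cidx M) (lsubmx z) /\ P0 (rsubmx z)].
Proof.
apply/seteqP; split=> z.
  move=> [w cw <-] /=; rewrite row_mxKl row_mxKr; split; last exact: tan_P0.
  by exists (val w).1.
move=> [/= [p cp pz] Pz]; have [w [wp wE]] := tan_point cp Pz.
exists w; first by rewrite /= wp.
by rewrite wE pz hsubmxK.
Qed.

Lemma tan_inj : chart_injective S.
Proof.
move=> c w w' cw cw'; rewrite !tan_cmapE => /eq_row_mx[E1 E2].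
apply/val_inj; have E := injM cw cw' E1; move: E2; rewrite -E => E2.
rewrite [LHS]surjective_pairing [RHS]surjective_pairing -E; congr pair.
have cd := atlas_dom aM (val w).1.
by rewrite -(dtransK aM (val w).2 cd cw) E2 (dtransK aM).
Qed.

Lemma tan_open (A : set 'rV[R]_n) : open A ->
  open [set z : 'rV[R]_(n + n) | A (lsubmx z) /\ P0 (rsubmx z)].
Proof. by move=> oA; exact: (open_block oA oP0). Qed.

Lemma tan_open_cimg (c : cidx M) : open (cimg (c : cidx S)).
Proof. by rewrite tan_cimg; apply: tan_open; exact: open_cimg. Qed.

Arguments tan_open_cimg : clear implicits.

Lemma tan_trans (c c' : cidx M) (w : {v | P v}) :
  cdom c (val w).1 -> cdom c' (val w).1 ->
  cmap (c' : cidx S) w =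
  tangent_map (crep c (cmap c')) (cmap (c : cidx S) w).
Proof.
move=> cw cw'; have c0w := atlas_dom aM (val w).1.
rewrite /tangent_map [lsubmx _]row_mxKl [rsubmx _]row_mxKr.
rewrite (crepE injM (cmap c') cw) -/(dtrans c c' _ _).
by rewrite (dtrans_comp aM _ c0w cw cw').
Qed.

Lemma tan_near_trans (c c' : cidx M) (w : {v | P v}) :
  cdom c (val w).1 -> cdom c' (val w).1 ->
  {near cmap (c : cidx S) w,
    tangent_map (crep c (cmap c')) =1 crep (c : cidx S) (cmap (c' : cidx S))}.
Proof.
move=> cw cw'.
have oW := tan_open (atlas_open aM c c').
have Wz : [set z : 'rV[R]_(n + n) | (cmap c @` (cdom c `&` cdom c')) (lsubmx z) /\
    P0 (rsubmx z)] (cmap (c : cidx S) w).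
  rewrite /= row_mxKl row_mxKr; split; last exact: tan_P0.
  by exists (val w).1.
apply: filterS (near_open oW Wz) => z [/= [p [cp cp'] pz] Pz].
have [q [qp qE]] := tan_point cp Pz.
rewrite -(hsubmxK z) -pz -qE (crepE tan_inj); last by rewrite /= qp.
by rewrite -tan_trans// qp.
Qed.

Lemma tan_derive_trans (c c' : cidx M) (w : {v | P v}) v :
  cdom c (val w).1 -> cdom c' (val w).1 ->
  'D_v (crep (c : cidx S) (cmap (c' : cidx S))) (cmap (c : cidx S) w) =
  'D_v (tangent_map (crep c (cmap c'))) (cmap (c : cidx S) w).
Proof.
by move=> cw cw'; rewrite (near_eq_derive v (tan_near_trans cw cw')).
Qed.

Lemma tan_vertical_trans (c c' : cidx M) (w : {v | P v}) xi :
  cdom c (val w).1 -> cdom c' (val w).1 ->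
  'D_(row_mx 0 xi) (crep (c : cidx S) (cmap (c' : cidx S))) (cmap (c : cidx S) w) =
  row_mx 0 (dtrans c c' (val w).1 xi).
Proof.
move=> cw cw'; rewrite tan_derive_trans//.
have U : (cmap c @` (cdom c `&` cdom c')) (lsubmx (cmap (c : cidx S) w)).
  by rewrite row_mxKl; exists (val w).1.
apply: etrans (derive_tangent_map_vertical (atlas_open aM c c')
  (atlas_smooth aM c c') xi U) _.
by rewrite [lsubmx _]row_mxKl.
Qed.

Lemma tan_derive_id (c : cidx M) (w : {v | P v}) v : cdom c (val w).1 ->
  'D_v (crep (c : cidx S) (cmap (c : cidx S))) (cmap (c : cidx S) w) = v.
Proof.
move=> cw; have cz : cimg (c : cidx S) (cmap (c : cidx S) w) by exists w.
have nE : {near cmap (c : cidx S) w, crep (c : cidx S) (cmap (c : cidx S)) =1 id}.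
  apply: filterS (near_open (tan_open_cimg c) cz) => _ [q cq <-].
  by rewrite (crepE tan_inj).
by rewrite (near_eq_derive v nE) derive_id.
Qed.

Section Lifts.
Variable E : {v | P v} -> R.
Hypothesis sE : smooth_fun S E.
Hypothesis gU : forall (c : cidx M) (w : {v | P v}), cdom c (val w).1 ->
  fund_tensor (crep (c : cidx S) E) (cmap (c : cidx S) w) \in unitmx.

Lemma tan_unitmx (c : cidx M) z : cimg (c : cidx S) z ->
  fund_tensor (crep (c : cidx S) E) z \in unitmx.
Proof. by move=> [w cw <-]; exact: gU. Qed.

(** Instance of [hvec_transform] over the overlap of the two charts, where [L] and [L'] are the same
    function [E] read in [c] and in [c']. Surjectivity of the derivative comes from the inverse
    transition. *)
Lemma tan_hvec_trans (c c' : cidx M) (w : {v | P v}) xi :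
  cdom c (val w).1 -> cdom c' (val w).1 ->
  'D_(hvec (crep (c : cidx S) E) (cmap (c : cidx S) w) xi)
    (crep (c : cidx S) (cmap (c' : cidx S))) (cmap (c : cidx S) w) =
  hvec (crep (c' : cidx S) E) (cmap (c' : cidx S) w) (dtrans c c' (val w).1 xi).
Proof.
move=> cw cw'; rewrite tan_derive_trans//.
rewrite (tan_trans cw cw') /dtrans.
pose U := cmap c @` (cdom c `&` cdom c').
pose W := [set z : 'rV[R]_(n + n) | U (lsubmx z) /\ P0 (rsubmx z)].
have WE z : W z -> exists q : {v | P v},
    [/\ cdom c (val q).1, cdom c' (val q).1 & cmap (c : cidx S) q = z].
  move=> [[p [cp cp'] pz] Pz]; have [q [qp qE]] := tan_point cp Pz.
  by exists q; rewrite qp qE pz hsubmxK.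
have oU : open U by exact: atlas_open.
have Wc : W `<=` cimg (c : cidx S).
  by move=> z /WE[q [cq cq' <-]]; exists q.
have surj (x v : 'rV[R]_n) : U x -> exists u, 'D_u (crep c (cmap c')) x = v.
  move=> [p [cp cp'] <-]; exists (dtrans c' c p v).
  by have := dtransK aM v cp' cp.
have Ww : W (cmap (c : cidx S) w).
  rewrite /W /= row_mxKl row_mxKr; split; last exact: tan_P0.
  by exists (val w).1.
have WW' z : W z -> cimg (c' : cidx S) (tangent_map (crep c (cmap c')) z).
  by move=> /WE[q [cq cq' <-]]; exists q; [exact: cq'|exact: (tan_trans cq cq')].
have LL' z : W z -> crep (c : cidx S) E z =
    crep (c' : cidx S) E (tangent_map (crep c (cmap c')) z).
  move=> /WE[q [cq cq' <-]].
  have E1 : crep (c : cidx S) E (cmap (c : cidx S) q) = E q.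
    exact: (crepE tan_inj E cq).
  have E2 : crep (c' : cidx S) E (cmap (c' : cidx S) q) = E q.
    exact: (crepE tan_inj E cq').
  have E3 := congr1 (crep (c' : cidx S) E) (tan_trans cq cq').
  exact: etrans E1 (etrans (esym E2) E3).
have sW : smooth_on W (crep (c : cidx S) E) by move=> k; exact: Ck_sub Wc (sE c k).
have gW z : W z -> fund_tensor (crep (c : cidx S) E) z \in unitmx.
  by move=> /Wc; exact: tan_unitmx.
have WU z : W z -> U (lsubmx z) by case.
have := @hvec_transform R n U (crep c (cmap c')) (crep (c : cidx S) E)
  (crep (c' : cidx S) E) W (cimg (c' : cidx S)) oU (atlas_smooth aM c c') surj
  (tan_open oU) sW (tan_open_cimg c') (sE c') gW (@tan_unitmx c') WU WW' LL'
  (cmap (c : cidx S) w) xi Ww.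
by rewrite [lsubmx _]row_mxKl.
Qed.

End Lifts.

End TangentBundle.
Arguments tan_open_cimg {R T n M P P0} _ _ _ _ c.

(** * Horizontal and vertical lifts of vector fields *)

Section Lifts.
Variables (R : realType) (T : choiceType) (n : nat) (M : charted R T n).
Variables (P : pred (T * 'rV[R]_n)) (P0 : pred 'rV[R]_n).
Hypothesis aM : atlas M.
Hypothesis PE : forall v, P v = P0 v.2.
Hypothesis oP0 : open [set y | P0 y].
Hypothesis P0_dtrans : forall (c c' : cidx M) p v, cdom c p -> cdom c' p ->
  P0 (dtrans c c' p v) = P0 v.
Let S := submanifold (tbundle M) P.
Variable E : {v | P v} -> R.
Hypothesis sE : smooth_fun S E.
Hypothesis gU : forall (c : cidx M) (w : {v | P v}), cdom c (val w).1 ->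
  fund_tensor (crep (c : cidx S) E) (cmap (c : cidx S) w) \in unitmx.

(** The preferred chart at [w] may change abruptly with the base point, so smoothness is not visible
    on this formula. It comes from [vcomp_hlift], which gives the same formula in any fixed
    chart. *)
Definition hlift (xi : T -> 'rV[R]_n) : vfield S := fun w =>
  hvec (crep (chart_at S w) E) (cmap (chart_at S w) w) (xi (val w).1).

Definition vlift (xi : T -> 'rV[R]_n) : vfield S := fun w =>
  row_mx 0 (xi (val w).1).

Lemma vcomp_hlift (c : cidx M) (xi : vfield M) w : cdom c (val w).1 ->
  vcomp (S := S) c (hlift xi) w =
  hvec (crep (c : cidx S) E) (cmap (c : cidx S) w) (vcomp c xi (val w).1).
Proof.
move=> cw; have c0w := atlas_dom aM (val w).1.
exact: (tan_hvec_trans aM PE oP0 P0_dtrans sE gU (xi (val w).1) c0w cw).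
Qed.

Lemma vcomp_vlift (c : cidx M) (xi : vfield M) w : cdom c (val w).1 ->
  vcomp (S := S) c (vlift xi) w = row_mx 0 (vcomp c xi (val w).1).
Proof.
move=> cw; have c0w := atlas_dom aM (val w).1.
exact: (tan_vertical_trans aM PE oP0 P0_dtrans (xi (val w).1) c0w cw).
Qed.

Lemma Ck_base k (c : cidx M) (xi : vfield M) : smooth_vfield xi ->
  Ck k (cimg (c : cidx S)) (fun z => crep c (vcomp c xi) (lsubmx z)).
Proof.
move=> sxi; have oc := tan_open_cimg aM PE oP0 P0_dtrans c.
apply: (Ck_comp_lsubmx (open_cimg aM c) oc _ (sxi c k)) => z.
by rewrite (tan_cimg aM PE P0_dtrans) => -[].
Qed.

Lemma smooth_vlift (xi : vfield M) : smooth_vfield xi -> smooth_vfield (vlift xi).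
Proof.
move=> sxi c k; have oc := tan_open_cimg aM PE oP0 P0_dtrans c.
have C := Ck_row_mx oc (Ck_cst oc k (0 : 'rV[R]_n)) (Ck_base k c sxi).
apply: (Ck_eq oc) C => _ [w cw <-].
rewrite [RHS](crepE (tan_inj aM (P:=P)) _ cw) [RHS]vcomp_vlift//.
by rewrite [lsubmx _]row_mxKl (crepE (atlas_inj aM) _ cw).
Qed.

Lemma smooth_hlift (xi : vfield M) : smooth_vfield xi -> smooth_vfield (hlift xi).
Proof.
move=> sxi c k; have oc := tan_open_cimg aM PE oP0 P0_dtrans c.
pose L := crep (c : cidx S) E.
have gc := @tan_unitmx _ _ _ _ _ _ gU c.
pose b (z : 'rV[R]_(n + n)) := crep (M := M) c (vcomp (S := M) c xi) (lsubmx z).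
pose f (z : 'rV[R]_(n + n)) : 'rV[R]_n :=
  \row_j (-1 * \sum_i b z 0 i * 'D_(e_y R i) (spray L j) z).
have Cb := Ck_base k c sxi.
have C : Ck k (cimg (c : cidx S)) (fun z => row_mx (b z) (f z)).
  apply: (Ck_row_mx oc) => //; apply: (Ck_rV oc) => j.
  have Cf : Ck k (cimg (c : cidx S))
      (fun z => -1 * \sum_i b z 0 i * 'D_(e_y R i) (spray L j) z).
    apply: (CkM oc); first exact: Ck_cst.
    apply: (Ck_sum oc) => i _; apply: (CkM oc).
      exact: (Ck_coord oc i Cb).
    exact: (smooth_derive _ (smooth_spray oc (sE c) gc j)).
  by apply: (Ck_eq oc) Cf => z _; rewrite mxE.
apply: (Ck_eq oc) C => _ [w cw <-]; set z := cmap _ w.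
have cz : cimg (c : cidx S) z by exists w.
have bz : b z = vcomp (S := M) c xi (val w).1.
  by rewrite /b [lsubmx _]row_mxKl (crepE (atlas_inj aM) _ cw).
rewrite [RHS](crepE (tan_inj aM (P:=P)) _ cw) [RHS]vcomp_hlift//.
rewrite -bz -/z -/L (hvecE oc (sE c) gc _ cz); congr row_mx.
have ds := differentiable_sprayv oc (sE c) gc cz.
rewrite (derive_row_mx_sum _ _ ds).
rewrite [X in _ = - (X + _)]big1 ?add0r; last by move=> i _; rewrite mxE scale0r.
apply/rowP => j; rewrite mxE mulN1r mxE summxE; congr (- _).
apply: eq_bigr => i _; rewrite [RHS]mxE; congr (_ * _).
exact: (esym (derive_sprayv_coord oc (sE c) gc _ _ cz)).
Qed.

End Lifts.

(** * The Vaisman connection along the fibres *)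

Section Reinhart.
Variables (R : realType) (T : choiceType) (n : nat) (M : charted R T n).
Variables (P : pred (T * 'rV[R]_n)) (P0 : pred 'rV[R]_n).
Hypothesis aM : atlas M.
Hypothesis PE : forall v, P v = P0 v.2.
Hypothesis oP0 : open [set y | P0 y].
Hypothesis P0_dtrans : forall (c c' : cidx M) p v, cdom c p -> cdom c' p ->
  P0 (dtrans c c' p v) = P0 v.
Let S := submanifold (tbundle M) P.
Variable E : {v | P v} -> R.
Hypothesis sE : smooth_fun S E.

Let L (w : {v | P v}) := crep (chart_at S w) E.
Let z (w : {v | P v}) := cmap (chart_at S w) w.

(** With [dw_slit] for [P] and [dw_sqr] for [E], these three definitions are convertible to
    [dw_vertical], [dw_horizontal] and [sasaki_matsumoto]. *)
Definition tan_vertical : Defs.distribution S :=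
  fun _ => <<[seq e_y R a | a <- enum 'I_n]>>%VS.

Definition tan_horizontal : Defs.distribution S :=
  fun w => <<[seq delta_x (L w) (z w) a | a <- enum 'I_n]>>%VS.

Definition tan_metric (w : {v | P v}) (zeta zeta' : 'rV[R]_(n + n)) : R :=
  sasaki_matsumoto_at (L w) (z w) zeta zeta'.

Lemma hvec_row_mx (f : 'rV[R]_(n + n) -> R) x xi :
  hvec f x xi = row_mx xi (- (xi *m (nonlin_conn f x)^T)).
Proof.
rewrite /hvec; under eq_bigr do rewrite scalerBr.
rewrite sumrB [RHS]row_mx_sum; congr (_ + _).
transitivity (- \sum_b \sum_a xi 0 a *: (nonlin_conn f x b a *: e_y R b)).
  by rewrite exchange_big; congr (- _); apply: eq_bigr => a _; rewrite scaler_sumr.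
rewrite -sumrN; apply: eq_bigr => b _.
under eq_bigr do rewrite scalerA.
rewrite -scaler_suml -scaleNr; congr (_ *: _).
rewrite [RHS]mxE; congr (- _); rewrite [RHS]mxE.
by apply: eq_bigr => a _; rewrite [_^T _ _]mxE.
Qed.

Lemma mem_verticalP w v : reflect (lsubmx v = 0) (v \in tan_vertical w).
Proof.
apply: (iffP idP).
  pose f : {linear 'rV[R]_(n + n) -> 'rV[R]_n} := lsubmx.
  have /subvP : (tan_vertical w <= lker (linfun f))%VS.
    apply/span_subvP => _ /mapP[a _ ->].
    by rewrite memv_ker lfunE /= /e_y row_mxKl.
  by move=> sub /sub; rewrite memv_ker lfunE /= => /eqP.
move=> v0; rewrite -[v]hsubmxK v0 row_mx_sum big1 ?add0r; last first.
  by move=> i _; rewrite mxE scale0r.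
apply: memv_suml => i _; apply: memvZ; apply: memv_span.
by apply: map_f; rewrite mem_enum.
Qed.

Lemma hvec_horizontal w xi : hvec (L w) (z w) xi \in tan_horizontal w.
Proof.
apply: memv_suml => i _; apply: memvZ; apply: memv_span.
by apply: map_f; rewrite mem_enum.
Qed.

Lemma mem_horizontalP w v :
  reflect (v = hvec (L w) (z w) (lsubmx v)) (v \in tan_horizontal w).
Proof.
apply: (iffP idP).
  (* This is the coframe [delta y] gathered in a row. Its kernel contains each [delta_x], hence
     their span, and a vector of the kernel is determined by its base part. *)
  pose g (v : 'rV[R]_(n + n)) : 'rV[R]_n :=
    rsubmx v + lsubmx v *m (nonlin_conn (L w) (z w))^T.
  have lin : linear g.
    move=> a u u'; rewrite /g !linearD !linearZ /= mulmxDl -scalemxAl.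
    by rewrite addrACA.
  pose f : {linear 'rV[R]_(n + n) -> 'rV[R]_n} :=
    HB.pack g (GRing.isLinear.Build _ _ _ _ _ lin).
  have /subvP : (tan_horizontal w <= lker (linfun f))%VS.
    apply/span_subvP => _ /mapP[a _ ->].
    have -> : delta_x (L w) (z w) a = hvec (L w) (z w) (delta_mx 0 a).
      rewrite /hvec (bigD1 a)//= mxE !eqxx scale1r big1 ?addr0// => b /negbTE ba.
      by rewrite mxE ba andbF scale0r.
    rewrite memv_ker lfunE /= /g hvec_row_mx row_mxKl row_mxKr addNr.
    exact: eqxx.
  move=> sub /sub; rewrite memv_ker lfunE /= /g addr_eq0 => /eqP E1.
  by rewrite hvec_row_mx -E1 hsubmxK.
by move=> ->; exact: hvec_horizontal.
Qed.

Lemma vertical_horizontal_cap w : (tan_horizontal w :&: tan_vertical w = 0)%VS.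
Proof.
apply/eqP; rewrite -subv0; apply/subvP => v /memv_capP[/mem_horizontalP Hv].
move=> /mem_verticalP v0; rewrite Hv v0 hvec_row_mx mul0mx oppr0 row_mx0.
exact: mem0v.
Qed.

Lemma vertical_horizontal_full w v : v \in (tan_horizontal w + tan_vertical w)%VS.
Proof.
have vV : v - hvec (L w) (z w) (lsubmx v) \in tan_vertical w.
  by apply/mem_verticalP; rewrite linearB /= hvec_row_mx row_mxKl subrr.
by have := memv_add (hvec_horizontal w (lsubmx v)) vV; rewrite addrC subrK.
Qed.

(** [daddv_pi] recovers a vector from its two parts because the sum is direct and full. A vector
    without horizontal part equals its vertical one. *)
Lemma daddv_pi_horizontal0 w v :
  daddv_pi (tan_horizontal w) (tan_vertical w) v = 0 -> lsubmx v = 0.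
Proof.
move=> v0; have := daddv_pi_add (vertical_horizontal_cap w)
  (vertical_horizontal_full w v).
by rewrite v0 add0r => <-; apply/mem_verticalP/memv_pi.
Qed.

Lemma delta_y_horizontal w v a : v \in tan_horizontal w ->
  delta_y (L w) (z w) v a = 0.
Proof.
move=> /mem_horizontalP ->; rewrite /delta_y hvec_row_mx row_mxKl row_mxKr.
rewrite mxE [X in - X]mxE addrC; apply/eqP; rewrite subr_eq0; apply/eqP.
by apply: eq_bigr => b _; rewrite mulrC [_^T _ _]mxE.
Qed.

(** Each term of the [delta y] part has one factor from each argument, so a single horizontal
    argument kills it. Hence only the base components of [nabla X Y] enter [nabla_metric]. *)
Lemma tan_metric_horizontal w u v :
  u \in tan_horizontal w \/ v \in tan_horizontal w ->
  tan_metric w u v = \sum_a \sum_b fund_tensor (L w) (z w) a b *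
    (lsubmx u 0 a * lsubmx v 0 b).
Proof.
move=> uv; rewrite /tan_metric /sasaki_matsumoto_at [X in _ + X]big1 ?addr0//.
move=> a _; rewrite big1// => b _.
by case: uv => h; rewrite (delta_y_horizontal _ h) ?mul0r ?mulr0 ?mul0r ?mulr0.
Qed.

End Reinhart.

Section ScalarProducts.
Variables (R : realType) (V : normedModType R).

Lemma derive_mul3 (f g k : V -> R) x v :
  derivable f x v -> derivable g x v -> derivable k x v ->
  derivable (fun y => f y * (g y * k y)) x v /\
  'D_v (fun y => f y * (g y * k y)) x =
  'D_v f x * (g x * k x) + f x * ('D_v g x * k x + g x * 'D_v k x).
Proof.
move=> df dg dk; have dgk : derivable (g * k) x v by exact: derivableM.
split; first exact: (derivableM df dgk).
have -> : (fun y => f y * (g y * k y)) = f * (g * k) by [].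
rewrite (deriveM df dgk) (deriveM dg dk) /GRing.scale /= !fctE.
move: ('D_v f x) ('D_v g x) ('D_v k x) => a b c; ring.
Qed.

Lemma derive_sum2 n (h : 'I_n -> 'I_n -> V -> R) x v :
  (forall a b, derivable (h a b) x v) ->
  'D_v (fun y => \sum_a \sum_b h a b y) x = \sum_a \sum_b 'D_v (h a b) x.
Proof.
move=> dh.
have -> : (fun y => \sum_a \sum_b h a b y) = \sum_a \sum_b h a b.
  by apply/funext => y; rewrite fct_sumE; apply: eq_bigr => a _; rewrite fct_sumE.
rewrite derive_sum; last by move=> a; exact: derivable_sum.
by apply: eq_bigr => a _; rewrite derive_sum.
Qed.

End ScalarProducts.

(** * Derivative of the metric in vertical directions *)

Section MetricDerivative.
Variables (R : realType) (T : choiceType) (n : nat) (M : charted R T n).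
Variables (P : pred (T * 'rV[R]_n)) (P0 : pred 'rV[R]_n).
Hypothesis aM : atlas M.
Hypothesis PE : forall v, P v = P0 v.2.
Hypothesis oP0 : open [set y | P0 y].
Hypothesis P0_dtrans : forall (c c' : cidx M) p v, cdom c p -> cdom c' p ->
  P0 (dtrans c c' p v) = P0 v.
Let S := submanifold (tbundle M) P.
Variable E : {v | P v} -> R.
Hypothesis sE : smooth_fun S E.
Let V : Defs.distribution S := @tan_vertical R T n M P.
Let H : Defs.distribution S := @tan_horizontal R T n M P E.
Let G : {v | P v} -> 'rV[R]_(n + n) -> 'rV[R]_(n + n) -> R :=
  @tan_metric R T n M P E.
Variable nabla : connection S.
Hypothesis nablaV : vaisman_connection V H G nabla.

Let oc (c : cidx S) : open (cimg c) := tan_open_cimg aM PE oP0 P0_dtrans c.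

Lemma lsubmx_derive m (F : 'rV[R]_m -> 'rV[R]_(n + n)) x v :
  differentiable F x ->
  lsubmx ('D_v F x) = 'D_v (fun y => lsubmx (F y)) x.
Proof.
move=> dF; have dl : differentiable (lsubmx : 'rV[R]_(n + n) -> 'rV[R]_n) (F x).
  exact: differentiable_lsubmx.
by rewrite [RHS](derive_comp_diff v dF dl) derive_lsubmx_lin.
Qed.

Lemma vertical_section X q : is_section V X -> lsubmx (X q) = 0.
Proof. by move=> [_ VX]; apply/(@mem_verticalP R T n M P q); exact: VX. Qed.

Lemma lsubmx_vcomp_vertical (c : cidx S) X q : is_section V X -> cdom c q ->
  lsubmx (vcomp c X q) = 0.
Proof.
move=> /(vertical_section q) X0 cq; have c0q := atlas_dom aM (val q).1.
have := tan_vertical_trans aM PE oP0 P0_dtrans (rsubmx (X q)) c0q cq.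
rewrite -{1}X0 hsubmxK => E1.
have {}E1 : vcomp c X q = _ := E1.
by rewrite E1 row_mxKl.
Qed.

(** In the term of the bracket that differentiates [X], the base components of [X] vanish
    identically in the chart, also off its image, where [crep] is 0. *)
Lemma lsubmx_bracket_vertical X Y w :
  is_section V X -> smooth_vfield Y ->
  lsubmx (bracket X Y w) = 'D_(X w) (fun z' =>
    lsubmx (crep (chart_at S w) (vcomp (chart_at S w) Y) z'))
    (cmap (chart_at S w) w).
Proof.
move=> sX sY; have [smX _] := sX; set c := chart_at S w; set z := cmap c w.
have c0w : cdom c w := atlas_dom aM (val w).1.
have cz : cimg c z by exists w.
have dX : differentiable (crep c (vcomp c X)) z.
  exact: smooth_differentiable (smX c) cz.
have dY : differentiable (crep c (vcomp c Y)) z.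
  exact: smooth_differentiable (sY c) cz.
have X0 : (fun y => lsubmx (crep c (vcomp c X) y)) = cst 0.
  apply/funext => y; have [cy|cy] := pselect (cimg c y); last first.
    by rewrite crep_out//= linear0.
  case: cy => q cq <-; rewrite (crepE (tan_inj aM (P := P)) _ cq).
  exact: lsubmx_vcomp_vertical.
have E1 := lsubmx_derive (X w) dY.
have E2 : lsubmx ('D_(Y w) (crep c (vcomp c X)) z) = 0.
  apply: etrans (lsubmx_derive (Y w) dX) _; rewrite X0; exact: derive_cst.
have lB (u v : 'rV[R]_(n + n)) : lsubmx (u - v) = lsubmx u - lsubmx v.
  exact: linearB.
apply: etrans (lB _ _) _.
exact: etrans (f_equal2 (fun a b => a - b) E1 E2) (subr0 _).
Qed.

(** The connection preserves vertical fields, so [nabla Y X] has no base components and drops out of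
    the torsion. *)
Lemma lsubmx_nabla X Y w : is_section V X -> is_section H Y ->
  lsubmx (nabla X Y w) = lsubmx (bracket X Y w).
Proof.
move=> sX sY; have [smX _] := sX; have [smY _] := sY.
have t0 := daddv_pi_horizontal0
  (vaisman_torsion_transversal nablaV smX smY (or_intror sY) w).
have N0 := vertical_section w (vaisman_structural nablaV smY sX).
move: t0; rewrite /torsion; move: (bracket X Y w) => b.
by rewrite !linearB /= N0 subr0 => /subr0_eq.
Qed.

(** By [lsubmx_nabla], the terms of the product rule that differentiate a component of [Y] or [Z]
    are those subtracted in [nabla_metric]. *)
Lemma nabla_metricE X Y Z w : is_section V X -> is_section H Y ->
  is_section H Z ->
  nabla_metric nabla G X Y Z w = \sum_a \sum_b
    'D_(X w) (fun z' => fund_tensor (crep (chart_at S w) E) z' a b)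
      (cmap (chart_at S w) w) *
    (lsubmx (Y w) 0 a * lsubmx (Z w) 0 b).
Proof.
move=> sX sY sZ; have [smY HY] := sY; have [smZ HZ] := sZ; have [_ VX] := sX.
set c := chart_at S w; set z := cmap c w.
have c0w : cdom c w := atlas_dom aM (val w).1.
have cz : cimg c z by exists w.
pose yc (Y : vfield S) z' := lsubmx (crep c (vcomp c Y) z').
have dyc Y' a : smooth_vfield Y' -> differentiable (fun z' => yc Y' z' 0 a) z.
  move=> sY'; apply: differentiable_rV_coord.
  have dF := smooth_differentiable (sY' c) cz.
  exact: (differentiable_comp dF (differentiable_lsubmx _)).
have ycq Y' q : (val q).1 = (val w).1 -> yc Y' (cmap c q) = lsubmx (Y' q).
  move=> qw; have cq : cdom c q by rewrite /= qw; exact: atlas_dom.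
  rewrite /yc (crepE (tan_inj aM (P := P)) _ cq).
  have cE : chart_at S q = c by rewrite /c /= qw.
  rewrite /vcomp /tmap cE.
  by rewrite (tan_derive_id aM PE oP0 P0_dtrans).
pose g a b z' := fund_tensor (crep c E) z' a b.
have dg a b : differentiable (g a b) z.
  have S0 := smooth_fund_tensor (@oc c) (sE c) a b.
  exact: (smooth_differentiable S0 cz).
pose h a b z' := g a b z' * (yc Y z' 0 a * yc Z z' 0 b).
have act : vf_act X (fun q => G q (Y q) (Z q)) w =
    'D_(X w) (fun z' => \sum_a \sum_b h a b z') z.
  (* The coordinate formula for [G q (Y q) (Z q)] uses the preferred chart at [q], which is [c] on
     the fibre through [w] but perhaps not nearby. The line along the vertical [X w] stays in that
     fibre. *)
  rewrite /vf_act /tmap -/c -/z; apply: near_derive_line.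
  have N := near_line (X w) (near_open (@oc c) cz).
  apply: filterS N => t [q cq qE]; rewrite -qE.
  have qw : (val q).1 = (val w).1.
    apply: (atlas_inj aM cq c0w).
    have := congr1 lsubmx qE; rewrite linearD linearZ /=.
    rewrite (vertical_section w sX) scaler0 add0r => lE.
    have l1 : lsubmx (cmap c q) = cmap (c : cidx M) (val q).1 := row_mxKl _ _.
    have l2 : lsubmx z = cmap (c : cidx M) (val w).1 := row_mxKl _ _.
    exact: etrans (esym l1) (etrans lE l2).
  have cE : chart_at S q = c by rewrite /c /= qw.
  rewrite (crepE (tan_inj aM (P := P)) _ cq) /G tan_metric_horizontal; last by left.
  by rewrite cE /h !ycq.
have dh a b := derive_mul3 (diff_derivable (v := X w) (dg a b))
  (diff_derivable (v := X w) (dyc Y a smY))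
  (diff_derivable (v := X w) (dyc Z b smZ)).
have nE Y' : is_section H Y' -> forall a, lsubmx (nabla X Y' w) 0 a =
    'D_(X w) (fun z' => yc Y' z' 0 a) z.
  move=> sY' a; have [smY' _] := sY'.
  rewrite (lsubmx_nabla w sX sY') (lsubmx_bracket_vertical w sX smY').
  apply: derive_coord; apply: differentiable_rV => j.
  exact: dyc.
rewrite /nabla_metric act derive_sum2; last by move=> a b; have [] := dh a b.
rewrite /G !tan_metric_horizontal; [|by left|by right].
rewrite -!sumrB; apply: eq_bigr => a _; rewrite -!sumrB; apply: eq_bigr => b _.
have [_ ->] := dh a b.
rewrite (nE Y sY a) (nE Z sZ b) !ycq// -/c -/z /g.
by rewrite mulrDr -[LHS]addrA -opprD addrK.
Qed.

End MetricDerivative.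

(** * Smooth vector fields with a prescribed value *)

Section BaseFields.
Variables (R : realType) (T : topologicalType) (n : nat) (M : charted R T n).
Hypothesis mM : smooth_manifold M.

Lemma manifold_atlas : atlas M.
Proof.
split.
- exact: (chart_inj mM).
- move=> c c'; apply: (chart_open_map mM); last by move=> p [].
  by apply: openI; exact: (chart_open mM).
- exact: (chart_at_dom mM).
- exact: (chart_transition mM).
Qed.

Let aM := manifold_atlas.

(** The set is the image of the compact [K] under the inverse chart, continuous because charts are
    open maps, and a compact subset of a Hausdorff space is closed. This makes extension by zero
    smooth. *)
Lemma closed_chart_compact (c : cidx M) (K : set 'rV[R]_n) : compact K ->
  K `<=` cimg c -> closed [set p | cdom c p /\ K (cmap c p)].
Proof.
move=> cK Kc; have [z0 Kz0|K0] := pselect (exists z, K z); last first.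
  have -> : [set p | cdom c p /\ K (cmap c p)] = set0; last exact: closed0.
  by apply/seteqP; split=> // p [_ Kp]; apply: K0; exists (cmap c p).
have [p0 _ _] := Kc _ (projT2 (cid z0)).
pose g z := xget p0 [set q | cdom c q /\ cmap c q = z].
have gE p : cdom c p -> g (cmap c p) = p.
  move=> cp; rewrite /g; case: xgetP => [q _ [cq qp]|/(_ p)[]//].
  exact: (chart_inj mM cq cp qp).
have -> : [set p | cdom c p /\ K (cmap c p)] = g @` K.
  apply/seteqP; split=> p.
    by move=> [cp Kp]; exists (cmap c p) => //; exact: gE.
  by move=> [z Kz <-]; have [q cq qz] := Kc z Kz; rewrite -qz gE// /= qz.
apply: (compact_closed (manifold_hausdorff mM)).
apply: continuous_compact => //; apply: continuous_in_subspaceT => z.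
rewrite inE => /Kc[p cp <-] A; rewrite gE// => nA.
have : nbhs p (A `&` cdom c).
  apply: filterI => //; apply: open_nbhs_nbhs; split=> //.
  exact: (chart_open mM).
rewrite nbhsE => -[B [oB Bp] BA].
have oB' : open (cmap c @` B) by apply: (chart_open_map mM) => // q /BA[].
have B'p : (cmap c @` B) (cmap c p) by exists p.
apply: filterS (near_open oB' B'p) => _ [q Bq <-].
by have [Aq cq] := BA _ Bq; rewrite /= gE.
Qed.

(** A field with constant components [v] in the chart at [p0] is multiplied by a bump function and
    extended by 0. *)
Lemma smooth_vfield_exists (p0 : T) (v : 'rV[R]_n) :
  exists xi : vfield M, smooth_vfield xi /\ xi p0 = v.
Proof.
set c := chart_at M p0; have cp0 : cdom c p0 := atlas_dom aM p0.
have cz0 : cimg c (cmap c p0) by exists p0.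
have [b [K [sb b1 cK Kc bK]]] := bump_exists (open_cimg aM c) cz0.
pose xi : vfield M := fun p => if `[< cdom c p >] then
  b (cmap c p) *: dtrans c (chart_at M p) p v else 0.
have xiE (c' : cidx M) p : cdom c p -> cdom c' p ->
    vcomp c' xi p = b (cmap c p) *: dtrans c c' p v.
  move=> cp cp'; have c0p := atlas_dom aM p.
  transitivity (dtrans (chart_at M p) c' p (xi p)); first by [].
  rewrite /xi; case: asboolP => // _.
  by rewrite (dtransZ aM _ _ c0p cp') (dtrans_comp aM _ cp c0p cp').
have xi0 (c' : cidx M) p : xi p = 0 -> vcomp c' xi p = 0.
  move=> xp; transitivity (dtrans (chart_at M p) c' p (xi p)); first by [].
  by rewrite xp dtrans0.
exists xi; split; last first.
  by rewrite /xi; case: asboolP => // _; rewrite b1 scale1r dtrans_id.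
move=> c' k; apply: Ck_cover => _ [p cp' <-].
have [cp|cp] := pselect (cdom c p).
  have oV := atlas_open aM c' c.
  exists (cmap c' @` (cdom c' `&` cdom c)); first by exists p.
  pose psi := crep c' (cmap c); pose phi := crep c (cmap c').
  have Cpsi := atlas_smooth aM c' c k.
  have psiV z : (cmap c' @` (cdom c' `&` cdom c)) z ->
      (cmap c @` (cdom c `&` cdom c')) (psi z).
    by move=> [q [cq' cq] <-]; exists q => //; rewrite /psi crepE//; exact: atlas_inj.
  have C : Ck k (cmap c' @` (cdom c' `&` cdom c))
      (fun z => \row_j (b (psi z) * ('D_v phi (psi z)) 0 j)).
    apply: (Ck_rV oV) => j.
    have C1 : Ck k (cmap c' @` (cdom c' `&` cdom c)) (b \o psi).
      by apply: (Ck_comp oV _ Cpsi (sb k)).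
    have C2 : Ck k (cmap c' @` (cdom c' `&` cdom c))
        ((fun z => ('D_v phi z) 0 j) \o psi).
      apply: (Ck_comp oV psiV Cpsi).
      apply: Ck_coord; first exact: atlas_open.
      exact: (smooth_derive v (atlas_smooth aM c c')).
    by apply: (Ck_eq oV) (CkM oV C1 C2) => z _; rewrite mxE.
  apply: (Ck_eq oV) C => _ [q [cq' cq] <-].
  rewrite [RHS](crepE (atlas_inj aM) _ cq') (xiE _ _ cq cq').
  rewrite /psi (crepE (atlas_inj aM) _ cq').
  by apply/rowP => j; rewrite mxE [RHS]mxE.
(* At a point outside the chart of the bump, the complement of the closed support is a neighbourhood
   on which the field is 0. *)
have cK' := closed_chart_compact cK Kc.
pose A := cdom c' `&` ~` [set p | cdom c p /\ K (cmap c p)].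
have oA : open A.
  by apply: openI; [exact: (chart_open mM)|exact: closed_openC].
have oV : open (cmap c' @` A) by apply: (chart_open_map mM) => // q [].
exists (cmap c' @` A); first by exists p => //; split=> // -[].
apply: (Ck_eq oV) (Ck_cst oV k (0 : 'rV[R]_n)) => _ [q [cq' Kq] <-].
rewrite [RHS](crepE (atlas_inj aM) _ cq') xi0//.
rewrite /xi; case: asboolP => // cq; rewrite bK ?scale0r// => Kcq.
exact: Kq.
Qed.

End BaseFields.

Section ProductFields.
Variables (R : realType) (T1 T2 : choiceType) (n1 n2 : nat).
Variables (M1 : charted R T1 n1) (M2 : charted R T2 n2).
Hypotheses (a1 : atlas M1) (a2 : atlas M2).
Let M := prod_charted M1 M2.

Lemma smooth_prod_vfield (xi1 : vfield M1) (xi2 : vfield M2) :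
  smooth_vfield xi1 -> smooth_vfield xi2 ->
  smooth_vfield (S := M) (fun p => row_mx (xi1 p.1) (xi2 p.2)).
Proof.
move=> s1 s2 c k; have aM := prod_atlas a1 a2.
have S := smooth_prod_crep a1 a2 (open_cimg a1 c.1) (open_cimg a2 c.2)
  (@subset_refl _ _) (@subset_refl _ _) (s1 c.1) (s2 c.2) k.
have cE : cimg c = [set z | cimg c.1 (lsubmx z) /\ cimg c.2 (rsubmx z)].
  by have := prod_overlap c c; rewrite !setIid.
rewrite -cE in S; apply: (Ck_eq (open_cimg aM c)) S => _ [p cp <-].
have inj := atlas_inj aM; rewrite !(crepE inj _ cp).
have c0p := atlas_dom aM p.
rewrite -[RHS]/(dtrans _ _ _ _) (prod_dtrans a1 a2 _ c0p cp).
by rewrite row_mxKl row_mxKr.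
Qed.

End ProductFields.

(** * Fibrewise derivatives of the energy *)

Section Fibre.
Variables (R : realType) (n : nat).

Lemma derive_fibre (W : normedModType R) m (f : 'rV[R]_(m + n) -> W) x y v :
  'D_(row_mx 0 v) f (row_mx x y) = 'D_v (fun y' => f (row_mx x y')) y.
Proof.
apply: derive_line => h; congr f.
by rewrite scale_row_mx scaler0 add_row_mx add0r.
Qed.

Lemma smooth_fibre (O : set 'rV[R]_n) m (W : set 'rV[R]_(m + n))
    (f : 'rV[R]_(m + n) -> R) x : open O ->
  (forall y, O y -> W (row_mx x y)) ->
  smooth_on W f -> smooth_on O (fun y => f (row_mx x y)).
Proof.
move=> oO OW sf k; apply: (Ck_comp oO OW _ (sf k)).
apply: (Ck_row_mx oO); first exact: Ck_cst.
by apply: (Ck_linear oO) => // y; exact: cvg_id.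
Qed.

Lemma fund_tensorE (L : 'rV[R]_(n + n) -> R) x y i j :
  fund_tensor L (row_mx x y) i j = 2^-1 *
  'D_(delta_mx 0 i) ('D_(delta_mx 0 j) (fun y' => L (row_mx x y'))) y.
Proof.
rewrite mxE /e_y derive_fibre.
suff -> : (fun y' => 'D_(row_mx 0 (delta_mx 0 j)) L (row_mx x y')) =
    'D_(delta_mx 0 j) (fun y' => L (row_mx x y')) by [].
by apply/funext => y'; rewrite derive_fibre.
Qed.

Lemma derive_fund_tensor (O : set 'rV[R]_n) (L : 'rV[R]_(n + n) -> R) x y v i j :
  open O -> O y -> smooth_on O (fun y' => L (row_mx x y')) ->
  'D_(row_mx 0 v) (fun z => fund_tensor L z i j) (row_mx x y) = 2^-1 *
  'D_v ('D_(delta_mx 0 i) ('D_(delta_mx 0 j) (fun y' => L (row_mx x y')))) y.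
Proof.
move=> oO Oy sl; rewrite derive_fibre.
have -> : (fun y' => fund_tensor L (row_mx x y') i j) = (fun y' => 2^-1 *:
    'D_(delta_mx 0 i) ('D_(delta_mx 0 j) (fun y' => L (row_mx x y'))) y').
  by apply/funext => y'; rewrite fund_tensorE.
apply: derive_scaler; apply: diff_derivable.
exact: smooth_differentiable (smooth_derive _ (smooth_derive _ sl)) Oy.
Qed.

(** Linearity is at hand only in the outermost direction, where the differentiated function is
    fixed. Symmetry brings each of the three directions to that place in turn. *)
Lemma third_derivative_eq0 (O : set 'rV[R]_n) (l : 'rV[R]_n -> R) y :
  open O -> O y -> smooth_on O l ->
  (forall i j k, 'D_(delta_mx 0 k) ('D_(delta_mx 0 i) ('D_(delta_mx 0 j) l)) y = 0) ->
  forall u v w, 'D_u ('D_v ('D_w l)) y = 0.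
Proof.
move=> oO Oy sl H.
have d2 v w : differentiable ('D_v ('D_w l)) y.
  exact: smooth_differentiable (smooth_derive v (smooth_derive w sl)) Oy.
have s12 u v w : 'D_u ('D_v ('D_w l)) y = 'D_v ('D_u ('D_w l)) y.
  exact: smooth_schwarz oO (smooth_derive w sl) Oy.
have s23 u v w : 'D_u ('D_v ('D_w l)) y = 'D_u ('D_w ('D_v l)) y.
  apply: near_eq_derive; apply: filterS (near_open oO Oy) => y' Oy'.
  exact: smooth_schwarz oO sl Oy'.
have lin v w : (forall k, 'D_(delta_mx 0 k) ('D_v ('D_w l)) y = 0) ->
    forall u, 'D_u ('D_v ('D_w l)) y = 0.
  move=> H0 u; rewrite (derive_sum_delta u (d2 v w)) big1// => k _.
  by rewrite H0 scaler0.
have H1 i j u : 'D_u ('D_(delta_mx 0 i) ('D_(delta_mx 0 j) l)) y = 0.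
  by apply: lin => k; exact: H.
have H2 j u v : 'D_u ('D_v ('D_(delta_mx 0 j) l)) y = 0.
  apply: etrans (s12 _ _ _) _; apply: lin => k.
  by apply: etrans (s12 _ _ _) _; exact: H1.
move=> u v w; apply: etrans (s23 _ _ _) _; apply: etrans (s12 _ _ _) _.
apply: lin => k; apply: etrans (s12 _ _ _) _; apply: etrans (s23 _ _ _) _.
exact: H2.
Qed.

End Fibre.

Section FibreBlock.
Variables (R : realType) (n1 n2 : nat).
Variables (O1 : set 'rV[R]_n1) (O2 : set 'rV[R]_n2).
Hypotheses (oO1 : open O1) (oO2 : open O2).
Let O := [set y : 'rV[R]_(n1 + n2) | O1 (lsubmx y) /\ O2 (rsubmx y)].

(** The conclusion has the shape of the hypothesis on [l], with the same constants, so the lemma can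
    be iterated to reach higher derivatives. *)
Lemma derive_block (a b : R) (l : 'rV[R]_(n1 + n2) -> R) l1 l2 u :
  smooth_on O1 l1 -> smooth_on O2 l2 ->
  (forall y, O y -> l y = a * l1 (lsubmx y) + b * l2 (rsubmx y)) ->
  forall y, O y ->
  'D_u l y = a * 'D_(lsubmx u) l1 (lsubmx y) + b * 'D_(rsubmx u) l2 (rsubmx y).
Proof.
move=> s1 s2 lE y Oy; have [Oy1 Oy2] := Oy.
have d1 : derivable (fun y' : 'rV[R]_(n1 + n2) => l1 (lsubmx y')) y u.
  apply: diff_derivable.
  exact: (differentiable_comp (differentiable_lsubmx _)
    (smooth_differentiable s1 Oy1)).
have d2 : derivable (fun y' : 'rV[R]_(n1 + n2) => l2 (rsubmx y')) y u.
  apply: diff_derivable.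
  exact: (differentiable_comp (differentiable_rsubmx _)
    (smooth_differentiable s2 Oy2)).
have nE : {near y, (fun y' => a *: l1 (lsubmx y')) \+
    (fun y' => b *: l2 (rsubmx y')) =1 l}.
  by apply: filterS (near_open (open_block oO1 oO2) Oy) => y' /lE ->.
rewrite -(near_eq_derive u nE) deriveD; [|exact: derivableZ|exact: derivableZ].
rewrite (derive_scaler a d1) (derive_scaler b d2).
by rewrite (derive_lsubmx l1) (derive_rsubmx l2).
Qed.

End FibreBlock.

(** * Finsler energies on the fibres *)

Section FinslerFibre.
Variables (R : realType) (T : choiceType) (n : nat) (M : charted R T n).
Variable F : T * 'rV[R]_n -> R.
Hypotheses (aM : atlas M) (fF : finsler_metric M F).
Let S := slit_tbundle M.

Definition nonzero : pred 'rV[R]_n := fun y => y != 0.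

Lemma open_nonzero : open [set y | nonzero y].
Proof.
have -> : [set y | nonzero y] = Num.norm @^-1` [set r : R | 0 < r].
  by apply/seteqP; split=> y /=; rewrite normr_gt0.
by apply: open_comp; [move=> y _; exact: norm_continuous|exact: open_gt].
Qed.

Lemma nonzero_dtrans (c c' : cidx M) p v : cdom c p -> cdom c' p ->
  nonzero (dtrans c c' p v) = nonzero v.
Proof.
move=> cp cp'; congr (~~ _); apply/eqP/eqP => [v0|->]; last exact: dtrans0.
by rewrite -(dtransK aM v cp cp') v0 dtrans0.
Qed.

Lemma slitE (v : T * 'rV[R]_n) : slit v = nonzero v.2. Proof. by []. Qed.

Let oc (c : cidx M) : open (cimg (c : cidx S)) :=
  tan_open_cimg aM slitE open_nonzero nonzero_dtrans c.
Arguments oc : clear implicits.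

Lemma smooth_energy : smooth_fun S (energy F).
Proof.
move=> c k; have sF := finsler_smooth fF c k.
apply: (Ck_eq (oc c)) (CkM (oc c) sF sF) => _ [w cw <-].
by rewrite !(crepE (tan_inj aM (P := slit (T := T) (n := n))) _ cw) -expr2.
Qed.

Definition fibre_energy (c : cidx M) p (y : 'rV[R]_n) : R :=
  crep (c : cidx S) (energy F) (row_mx (cmap c p) y).

Lemma smooth_fibre_energy (c : cidx M) p : cdom c p ->
  smooth_on [set y | nonzero y] (fibre_energy c p).
Proof.
move=> cp; apply: (smooth_fibre (W := cimg (c : cidx S))).
- exact: open_nonzero.
- move=> y y0; rewrite (tan_cimg aM slitE nonzero_dtrans) /= row_mxKl row_mxKr.
  by split=> //; exists p.
- exact: smooth_energy.
Qed.

Lemma cartan_tensorE (c : cidx M) p y i j k : cdom c p -> nonzero y ->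
  cartan_tensor (crep (c : cidx S) (energy F)) i j k (row_mx (cmap c p) y) =
  2^-1 * (2^-1 * 'D_(delta_mx 0 k) ('D_(delta_mx 0 i)
    ('D_(delta_mx 0 j) (fibre_energy c p))) y).
Proof.
move=> cp y0; congr (_ * _).
exact: derive_fund_tensor open_nonzero y0 (smooth_fibre_energy cp).
Qed.

Lemma riemannian_third_derivative (c : cidx M) p y u v w : is_riemannian M F ->
  cdom c p -> nonzero y -> 'D_u ('D_v ('D_w (fibre_energy c p))) y = 0.
Proof.
move=> rF cp y0.
apply: (third_derivative_eq0 open_nonzero y0 (smooth_fibre_energy cp)) => i j k.
have [q [qp qE]] := tan_point aM slitE nonzero_dtrans cp y0.
have cq : cdom (c : cidx S) q by rewrite /= qp.
have := rF c q cq i j k; rewrite qE (cartan_tensorE _ _ _ cp y0) => /eqP.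
by rewrite !mulf_eq0 !invr_eq0 !pnatr_eq0 /= => /eqP.
Qed.

(** A nonzero [y] is a point of the slit bundle, and both sides are its energy. At [y = 0] both
    sides are the default value 0 of [crep]. *)
Lemma fibre_energy_dtrans (c : cidx M) p y : cdom c p ->
  fibre_energy c p (dtrans (chart_at M p) c p y) =
  fibre_energy (chart_at M p) p y.
Proof.
move=> cp; have c0p := atlas_dom aM p.
have [y0|y0] := boolP (nonzero y); last first.
  have out (c' : cidx M) y' : ~~ nonzero y' -> fibre_energy c' p y' = 0.
    move=> y'0; apply: crep_out; rewrite (tan_cimg aM slitE nonzero_dtrans) /=.
    by rewrite row_mxKr => -[_]; exact/negP.
  by rewrite !out// nonzero_dtrans.
pose w : {v | slit v} := exist (fun v => slit v) (p, y) y0.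
have fE (c' : cidx M) : cdom c' p ->
    fibre_energy c' p (dtrans (chart_at M p) c' p y) = energy F w.
  move=> cp'; have cw : cdom (c' : cidx S) w by [].
  exact: (crepE (tan_inj aM (P := slit (T := T) (n := n))) (energy F) cw).
by rewrite (fE c cp) -(fE _ c0p) dtrans_id.
Qed.

(** A change of charts is linear on a fibre, so derivatives in any chart are derivatives in the
    preferred one along transformed constant directions. This is why arbitrary [u], [v], [w]
    appear. *)
Lemma riemannianP :
  (forall p y u v w, nonzero y ->
    'D_u ('D_v ('D_w (fibre_energy (chart_at M p) p))) y = 0) ->
  is_riemannian M F.
Proof.
move=> H c v cv i j k; set p := (val v).1.
have cp : cdom (c : cidx M) p := cv.
have c0p := atlas_dom aM p; pose A := dtrans (chart_at M p) c p.
have v0 : nonzero (val v).2 by rewrite -slitE; exact: valP.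
have -> : cmap (c : cidx S) v = row_mx (cmap (c : cidx M) p) (A (val v).2) by [].
have Av0 : nonzero (A (val v).2) by rewrite nonzero_dtrans.
rewrite (cartan_tensorE _ _ _ cp Av0).
pose B := dtrans (c : cidx M) (chart_at M p) p.
have AB u : A (B u) = u by exact: dtransK.
have DA (f g : 'rV[R]_n -> R) a : (forall y, f (A y) = g y) ->
    forall y, 'D_a f (A y) = 'D_(B a) g y.
  move=> fg y; rewrite -{1}(AB a); apply: derive_line => h.
  by rewrite -(dtransP aM h (B a) y c0p cp); exact: fg.
pose l := fibre_energy c p; pose l0 := fibre_energy (chart_at M p) p.
pose ei : 'rV[R]_n := delta_mx 0 i; pose ej : 'rV[R]_n := delta_mx 0 j.
pose ek : 'rV[R]_n := delta_mx 0 k.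
have E1 := DA l l0 ej (fun y => fibre_energy_dtrans y cp).
have E2 := DA ('D_ej l) ('D_(B ej) l0) ei E1.
have E3 := DA ('D_ei ('D_ej l)) ('D_(B ei) ('D_(B ej) l0)) ek E2 (val v).2.
have E4 := etrans E3 (H p (val v).2 (B ek) (B ei) (B ej) v0).
by rewrite [X in _ * (_ * X)]E4 !mulr0.
Qed.

Lemma posdef_unitmx m (A : 'M[R]_m) :
  (forall xi : 'rV[R]_m, xi != 0 -> 0 < (xi *m A *m xi^T) 0 0) -> A \in unitmx.
Proof.
move=> pos; rewrite unitmxE unitfE; apply/negP => /det0P[xi xi0 xiA].
by have := pos xi xi0; rewrite xiA mul0mx mxE ltxx.
Qed.

Lemma finsler_unitmx (c : cidx M) p y : cdom c p -> nonzero y ->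
  fund_tensor (crep (c : cidx S) (energy F)) (row_mx (cmap c p) y) \in unitmx.
Proof.
move=> cp y0; have [q [qp <-]] := tan_point aM slitE nonzero_dtrans cp y0.
apply: posdef_unitmx => xi xi0; apply: (finsler_convex fF) => //.
by rewrite /= qp.
Qed.

End FinslerFibre.

(** * Doubly warped products *)

Section DoublyWarped.
Variables (R : realType) (T1 T2 : choiceType) (n1 n2 : nat).
Variables (M1 : charted R T1 n1) (M2 : charted R T2 n2).
Variables (F1 : T1 * 'rV[R]_n1 -> R) (F2 : T2 * 'rV[R]_n2 -> R).
Variables (f1 : T1 -> R) (f2 : T2 -> R).
Hypotheses (a1 : atlas M1) (a2 : atlas M2).
Hypotheses (fF1 : finsler_metric M1 F1) (fF2 : finsler_metric M2 F2).
Hypotheses (sf1 : smooth_fun M1 f1) (sf2 : smooth_fun M2 f2).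
Hypotheses (f1_gt0 : forall p, 0 < f1 p) (f2_gt0 : forall p, 0 < f2 p).

Let M := prod_charted M1 M2.
Let aM : atlas M := prod_atlas a1 a2.
Let P := @dw_slit R T1 T2 n1 n2.
Let S := dw_tbundle M1 M2.

Definition nonzero2 : pred 'rV[R]_(n1 + n2) :=
  fun y => nonzero (lsubmx y) && nonzero (rsubmx y).

Lemma dw_slitE v : P v = nonzero2 v.2. Proof. by []. Qed.

Lemma nonzero2E : [set y | nonzero2 y] =
  [set y | nonzero (lsubmx y) /\ nonzero (rsubmx y)].
Proof. by apply/seteqP; split=> y /= /andP. Qed.

Lemma open_nonzero2 : open [set y | nonzero2 y].
Proof.
rewrite nonzero2E.
exact: (open_block (@open_nonzero R n1) (@open_nonzero R n2)).
Qed.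

Lemma nonzero2_dtrans (c c' : cidx M) p v : cdom c p -> cdom c' p ->
  nonzero2 (dtrans c c' p v) = nonzero2 v.
Proof.
move=> cp cp'; rewrite (prod_dtrans a1 a2 _ cp cp') /nonzero2 row_mxKl row_mxKr.
case: cp cp' => [h1 h2] [h1' h2'].
by rewrite (nonzero_dtrans a1 _ h1 h1') (nonzero_dtrans a2 _ h2 h2').
Qed.

Let oc (c : cidx M) : open (cimg (c : cidx S)) :=
  tan_open_cimg aM dw_slitE open_nonzero2 nonzero2_dtrans c.
Arguments oc : clear implicits.

Definition dw_sqr (w : {v | P v}) : R := dw_metric F1 F2 f1 f2 (val w) ^+ 2.

Lemma dw_sqrE (c : cidx M) (p : T1 * T2) y : cdom c p -> nonzero2 y ->
  crep (c : cidx S) dw_sqr (row_mx (cmap c p) y) =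
  f2 p.2 ^+ 2 * fibre_energy F1 c.1 p.1 (lsubmx y) +
  f1 p.1 ^+ 2 * fibre_energy F2 c.2 p.2 (rsubmx y).
Proof.
move=> cp y0; have [q [qp qE]] := tan_point aM dw_slitE nonzero2_dtrans cp y0.
have cq : cdom (c : cidx S) q by rewrite /= qp.
rewrite -qE (crepE (tan_inj aM (P := P)) _ cq).
have /andP[q1 q2] := valP q.
pose w1 : {v | slit v} := exist (fun v => slit v) _ q1.
pose w2 : {v | slit v} := exist (fun v => slit v) _ q2.
have [h1 h2] := cp.
have := qE; rewrite tan_cmapE qp => /eq_row_mx[_ yE].
have c0p := atlas_dom aM p.
rewrite (prod_dtrans a1 a2 _ c0p cp) in yE.
have cw1 : cdom (c.1 : cidx (slit_tbundle M1)) w1 by rewrite /= /tproj1 qp.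
have cw2 : cdom (c.2 : cidx (slit_tbundle M2)) w2 by rewrite /= /tproj2 qp.
have E1 : fibre_energy F1 c.1 p.1 (lsubmx y) = energy F1 w1.
  rewrite -yE row_mxKl -(crepE (tan_inj a1 (P := @slit R T1 n1)) (energy F1) cw1).
  by rewrite tan_cmapE /= /tproj1 qp.
have E2 : fibre_energy F2 c.2 p.2 (rsubmx y) = energy F2 w2.
  rewrite -yE row_mxKr -(crepE (tan_inj a2 (P := @slit R T2 n2)) (energy F2) cw2).
  by rewrite tan_cmapE /= /tproj2 qp.
rewrite E1 E2 /dw_sqr /dw_metric sqr_sqrtr; last first.
  by rewrite addr_ge0// mulr_ge0// sqr_ge0.
by rewrite /energy /= /tproj1 /tproj2 /= qp.
Qed.

Lemma Ck_coordwise k N m (U : set 'rV[R]_N) (f : 'rV[R]_N -> 'rV[R]_m)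
    (s : 'I_m -> 'I_N) : open U -> (forall x j, f x 0 j = x 0 (s j)) -> Ck k U f.
Proof.
move=> oU fE; apply: (Ck_rV oU) => j.
by apply: (Ck_eq oU) (Ck_coordinate k (s j) oU) => x _; rewrite fE.
Qed.

Lemma smooth_dw_sqr : smooth_fun S dw_sqr.
Proof.
suff H (c : cidx M) : smooth_on (cimg (c : cidx S)) (crep (c : cidx S) dw_sqr).
  by exact: H.
move=> k; have o := oc c.
(* Coordinates on the product bundle come in the order [(x1, x2, y1, y2)], while the two factors use
   [(x1, y1)] and [(x2, y2)]; the four blocks are regrouped. *)
pose x1 (z : 'rV[R]_(n1 + n2 + (n1 + n2))) : 'rV[R]_n1 := lsubmx (lsubmx z).
pose x2 (z : 'rV[R]_(n1 + n2 + (n1 + n2))) : 'rV[R]_n2 := rsubmx (lsubmx z).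
pose y1 (z : 'rV[R]_(n1 + n2 + (n1 + n2))) : 'rV[R]_n1 := lsubmx (rsubmx z).
pose y2 (z : 'rV[R]_(n1 + n2 + (n1 + n2))) : 'rV[R]_n2 := rsubmx (rsubmx z).
have Cx1 : Ck k (cimg (c : cidx S)) x1.
  by apply: (@Ck_coordwise k _ _ _ _ (fun j => lshift _ (lshift _ j)) o) => //
    x j; rewrite !mxE.
have Cx2 : Ck k (cimg (c : cidx S)) x2.
  by apply: (@Ck_coordwise k _ _ _ _ (fun j => lshift _ (rshift _ j)) o) => //
    x j; rewrite !mxE.
have Cy1 : Ck k (cimg (c : cidx S)) y1.
  by apply: (@Ck_coordwise k _ _ _ _ (fun j => rshift _ (lshift _ j)) o) => //
    x j; rewrite !mxE.
have Cy2 : Ck k (cimg (c : cidx S)) y2.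
  by apply: (@Ck_coordwise k _ _ _ _ (fun j => rshift _ (rshift _ j)) o) => //
    x j; rewrite !mxE.
have imgE z : cimg (c : cidx S) z -> exists (p : T1 * T2)
    (y : 'rV[R]_(n1 + n2)), [/\ cdom (c : cidx M) p, nonzero2 y &
    z = row_mx (cmap (c : cidx M) p) y].
  rewrite (tan_cimg aM dw_slitE nonzero2_dtrans) => -[[p cp pz] z0].
  by exists p, (rsubmx z); split=> //; rewrite pz hsubmxK.
have Cf1 : Ck k (cimg (c : cidx S)) (crep c.1 f1 \o x1).
  apply: (Ck_comp o _ Cx1 (sf1 c.1 k)) => _ /imgE[p [y [[h1 h2] _ ->]]].
  by exists p.1; rewrite /x1 ?row_mxKl.
have Cf2 : Ck k (cimg (c : cidx S)) (crep c.2 f2 \o x2).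
  apply: (Ck_comp o _ Cx2 (sf2 c.2 k)) => _ /imgE[p [y [[h1 h2] _ ->]]].
  by exists p.2; rewrite /x2 ?row_mxKl ?row_mxKr.
pose L1 := crep (c.1 : cidx (slit_tbundle M1)) (energy F1).
pose L2 := crep (c.2 : cidx (slit_tbundle M2)) (energy F2).
have CL1 : Ck k (cimg (c : cidx S)) (L1 \o (fun z => row_mx (x1 z) (y1 z))).
  apply: (Ck_comp o _ (Ck_row_mx o Cx1 Cy1) (smooth_energy a1 fF1 c.1 k)).
  move=> _ /imgE[p [y [[h1 h2] /andP[y10 y20] ->]]].
  rewrite (tan_cimg a1 (@slitE R T1 n1) (nonzero_dtrans a1)) /=.
  rewrite /x1 /y1 !row_mxKl !row_mxKr; split=> //.
  by exists p.1.
have CL2 : Ck k (cimg (c : cidx S)) (L2 \o (fun z => row_mx (x2 z) (y2 z))).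
  apply: (Ck_comp o _ (Ck_row_mx o Cx2 Cy2) (smooth_energy a2 fF2 c.2 k)).
  move=> _ /imgE[p [y [[h1 h2] /andP[y10 y20] ->]]].
  rewrite (tan_cimg a2 (@slitE R T2 n2) (nonzero_dtrans a2)) /=.
  rewrite /x2 /y2 !row_mxKl !row_mxKr; split=> //.
  by exists p.2.
have C := CkD o (CkM o (CkM o Cf2 Cf2) CL1) (CkM o (CkM o Cf1 Cf1) CL2).
apply: (Ck_eq o) C => _ /imgE[p [y [cp y0 ->]]].
have [h1 h2] := cp; rewrite [RHS](dw_sqrE cp y0) /=.
rewrite /x1 /x2 /y1 /y2 !(row_mxKl, row_mxKr).
by rewrite (crepE (atlas_inj a1) _ h1) (crepE (atlas_inj a2) _ h2) -!expr2.
Qed.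

Section AtPoint.
Variables (c : cidx M) (p : T1 * T2).
Hypothesis cp : cdom c p.
Let l1 := fibre_energy F1 c.1 p.1.
Let l2 := fibre_energy F2 c.2 p.2.
Let l y := crep (c : cidx S) dw_sqr (row_mx (cmap c p) y).
Let a := f2 p.2 ^+ 2.
Let b := f1 p.1 ^+ 2.

Let sl1 : smooth_on [set y | nonzero y] l1.
Proof. by apply: smooth_fibre_energy => //; case: cp. Qed.

Let sl2 : smooth_on [set y | nonzero y] l2.
Proof. by apply: smooth_fibre_energy => //; case: cp. Qed.

Lemma dw_derive2 u v y : nonzero2 y -> 'D_u ('D_v l) y =
  a * 'D_(lsubmx u) ('D_(lsubmx v) l1) (lsubmx y) +
  b * 'D_(rsubmx u) ('D_(rsubmx v) l2) (rsubmx y).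
Proof.
move=> /andP y0; have o1 := @open_nonzero R n1; have o2 := @open_nonzero R n2.
apply: (derive_block o1 o2 _ (smooth_derive _ sl1) (smooth_derive _ sl2)) => //.
apply: (derive_block o1 o2 _ sl1 sl2) => y' /andP y'0.
exact: dw_sqrE.
Qed.

Lemma dw_derive3 u v w y : nonzero2 y -> 'D_u ('D_v ('D_w l)) y =
  a * 'D_(lsubmx u) ('D_(lsubmx v) ('D_(lsubmx w) l1)) (lsubmx y) +
  b * 'D_(rsubmx u) ('D_(rsubmx v) ('D_(rsubmx w) l2)) (rsubmx y).
Proof.
move=> /andP y0; have o1 := @open_nonzero R n1; have o2 := @open_nonzero R n2.
apply: (derive_block o1 o2 _ (smooth_derive _ (smooth_derive _ sl1))
  (smooth_derive _ (smooth_derive _ sl2))) => //.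
by move=> y' /andP y'0; exact: dw_derive2.
Qed.

Lemma smooth_dw_fibre : smooth_on [set y | nonzero2 y] l.
Proof.
apply: (smooth_fibre (W := cimg (c : cidx S))).
- exact: open_nonzero2.
- move=> y y0; rewrite (tan_cimg aM dw_slitE nonzero2_dtrans) /= row_mxKl row_mxKr.
  by split=> //; exists p.
- exact: smooth_dw_sqr.
Qed.

Lemma dw_derive_fund_tensor v i j y : nonzero2 y ->
  'D_(row_mx 0 v) (fun z => fund_tensor (crep (c : cidx S) dw_sqr) z i j)
    (row_mx (cmap c p) y) =
  2^-1 * 'D_v ('D_(delta_mx 0 i) ('D_(delta_mx 0 j) l)) y.
Proof.
by move=> y0; exact: derive_fund_tensor open_nonzero2 y0 smooth_dw_fibre.
Qed.

Lemma lsubmx_delta_l m1 m2 (i : 'I_m1) :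
  lsubmx (delta_mx 0 (lshift m2 i) : 'rV[R]_(m1 + m2)) = delta_mx 0 i.
Proof. by apply/rowP => j; rewrite !mxE eq_lshift. Qed.

Lemma rsubmx_delta_l m1 m2 (i : 'I_m1) :
  rsubmx (delta_mx 0 (lshift m2 i) : 'rV[R]_(m1 + m2)) = 0.
Proof. by apply/rowP => j; rewrite !mxE eq_rlshift andbF. Qed.

Lemma lsubmx_delta_r m1 m2 (i : 'I_m2) :
  lsubmx (delta_mx 0 (rshift m1 i) : 'rV[R]_(m1 + m2)) = 0.
Proof. by apply/rowP => j; rewrite !mxE eq_lrshift andbF. Qed.

Lemma rsubmx_delta_r m1 m2 (i : 'I_m2) :
  rsubmx (delta_mx 0 (rshift m1 i) : 'rV[R]_(m1 + m2)) = delta_mx 0 i.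
Proof. by apply/rowP => j; rewrite !mxE eq_rshift. Qed.

Lemma derive_derive0 m (f : 'rV[R]_m -> R) u x : 'D_u ('D_0 f) x = 0.
Proof.
have -> : 'D_0 f = cst 0 by apply/funext => y; rewrite derive0.
exact: derive_cst.
Qed.

(** On a fibre each summand of the energy depends on one block of variables, so mixed second
    derivatives vanish. *)
Lemma dw_fund_tensor y : nonzero2 y ->
  fund_tensor (crep (c : cidx S) dw_sqr) (row_mx (cmap c p) y) =
  block_mx
    (a *: fund_tensor (crep (c.1 : cidx (slit_tbundle M1)) (energy F1))
      (row_mx (cmap c.1 p.1) (lsubmx y))) 0 0
    (b *: fund_tensor (crep (c.2 : cidx (slit_tbundle M2)) (energy F2))
      (row_mx (cmap c.2 p.2) (rsubmx y))).
Proof.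
move=> y0; apply/matrixP => i j; rewrite fund_tensorE dw_derive2//.
case: (split_ordP i) => i' ->; case: (split_ordP j) => j' ->.
- rewrite block_mxEul mxE fund_tensorE !lsubmx_delta_l !rsubmx_delta_l.
  by rewrite derive0 mulr0 addr0 mulrCA.
- rewrite block_mxEur mxE lsubmx_delta_r rsubmx_delta_l derive0 derive_derive0.
  by rewrite !mulr0 addr0 mulr0.
- rewrite block_mxEdl mxE lsubmx_delta_r rsubmx_delta_l derive0 derive_derive0.
  by rewrite !mulr0 addr0 mulr0.
- rewrite block_mxEdr mxE fund_tensorE !lsubmx_delta_r !rsubmx_delta_r.
  by rewrite derive0 mulr0 add0r mulrCA.
Qed.

Lemma dw_unitmx y : nonzero2 y ->
  fund_tensor (crep (c : cidx S) dw_sqr) (row_mx (cmap c p) y) \in unitmx.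
Proof.
move=> y0; have /andP[y10 y20] := y0; have [h1 h2] := cp.
rewrite dw_fund_tensor// unitmxE det_ublock unitrM -!unitmxE.
rewrite !unitmxZ ?unitfE ?expf_neq0 ?gt_eqF//.
by rewrite (finsler_unitmx a1 fF1 h1 y10) (finsler_unitmx a2 fF2 h2 y20).
Qed.

End AtPoint.

End DoublyWarped.

(** * The two implications *)

Section Characterization.
Variables (R : realType) (T1 T2 : topologicalType) (n1 n2 : nat).
Variables (M1 : charted R T1 n1) (M2 : charted R T2 n2).
Variables (F1 : T1 * 'rV[R]_n1 -> R) (F2 : T2 * 'rV[R]_n2 -> R).
Variables (f1 : T1 -> R) (f2 : T2 -> R).
Hypotheses (m1 : smooth_manifold M1) (m2 : smooth_manifold M2).
Hypotheses (fF1 : finsler_metric M1 F1) (fF2 : finsler_metric M2 F2).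
Hypotheses (sf1 : smooth_fun M1 f1) (sf2 : smooth_fun M2 f2).
Hypotheses (f1_gt0 : forall p, 0 < f1 p) (f2_gt0 : forall p, 0 < f2 p).

Let a1 := manifold_atlas m1.
Let a2 := manifold_atlas m2.
Let M := prod_charted M1 M2.
Let aM : atlas M := prod_atlas a1 a2.
Let P := @dw_slit R T1 T2 n1 n2.
Let S := dw_tbundle M1 M2.
Let E := dw_sqr F1 F2 f1 f2.
Let PE := @dw_slitE R T1 T2 n1 n2.
Let oP := @open_nonzero2 R n1 n2.
Let PD := nonzero2_dtrans a1 a2.
Let V := dw_vertical M1 M2.
Let H := dw_horizontal M1 M2 F1 F2 f1 f2.
Let G := sasaki_matsumoto M1 M2 F1 F2 f1 f2.
Variable nabla : connection S.
Hypothesis nablaV : vaisman_connection V H G nabla.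

Let sE : smooth_fun S E.
Proof. exact: smooth_dw_sqr. Qed.

Let gU (c : cidx M) (w : {v | P v}) : cdom c (val w).1 ->
  fund_tensor (crep (c : cidx S) E) (cmap (c : cidx S) w) \in unitmx.
Proof.
move=> cw; have y0 := tan_P0 aM PE PD cw.
exact: (dw_unitmx a1 a2 fF1 fF2 f1_gt0 f2_gt0 cw y0).
Qed.

Lemma prod_vfield_exists (p : T1 * T2) (v : 'rV[R]_(n1 + n2)) :
  exists xi : vfield M, smooth_vfield xi /\ xi p = v.
Proof.
have [xi1 [s1 e1]] := smooth_vfield_exists m1 p.1 (lsubmx v).
have [xi2 [s2 e2]] := smooth_vfield_exists m2 p.2 (rsubmx v).
exists (fun q => row_mx (xi1 q.1) (xi2 q.2)); split.
  exact: (smooth_prod_vfield a1 a2 s1 s2).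
by rewrite e1 e2 hsubmxK.
Qed.

(** The Reinhart condition is tested on the vertical lift of a field equal to [v] at [p] and on the
    horizontal lifts of fields equal to the basis vectors [i] and [j] there. A single term of the
    double sum survives. *)
Lemma reinhart_fund_tensor (p : T1 * T2) y v i j :
  reinhart_space V H G nabla -> nonzero2 y ->
  'D_(row_mx 0 v) (fun z => fund_tensor (crep (chart_at M p : cidx S) E) z i j)
    (row_mx (cmap (chart_at M p) p) y) = 0.
Proof.
move=> HR y0; have c0p := atlas_dom aM p.
pose w : {v | P v} := exist (fun v => P v) (p, y) y0.
have zE : cmap (chart_at S w) w = row_mx (cmap (chart_at M p) p) y.
  apply: (f_equal2 (fun a b => row_mx a b)) => //; exact: (dtrans_id aM _ c0p).
have [xi [sxi xip]] := prod_vfield_exists p v.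
have [eta [seta etap]] := prod_vfield_exists p (delta_mx 0 i).
have [zeta [szeta zetap]] := prod_vfield_exists p (delta_mx 0 j).
have sX : is_section V (@vlift R _ _ M P xi).
  split; first exact: (smooth_vlift aM PE oP PD sxi).
  by move=> q; apply/(@mem_verticalP R _ _ M P q); rewrite row_mxKl.
have sH (u : vfield M) : smooth_vfield u -> is_section H (@hlift R _ _ M P E u).
  move=> su; split; first exact: (smooth_hlift aM PE oP PD sE gU su).
  by move=> q; exact: hvec_horizontal.
have := HR _ _ _ sX (sH _ seta) (sH _ szeta) w.
rewrite (nabla_metricE aM PE oP PD sE nablaV w sX (sH _ seta) (sH _ szeta)).
have lE (u : vfield M) : lsubmx (@hlift R _ _ M P E u w) = u p.
  by rewrite /hlift hvec_row_mx row_mxKl.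
rewrite !lE etap zetap zE.
rewrite (bigD1 i)//= [X in _ + X]big1 ?addr0; last first.
  move=> i' /negbTE ii; rewrite big1// => j' _.
  by rewrite !mxE ii mul0r mulr0.
rewrite (bigD1 j)//= [X in _ + X]big1 ?addr0; last first.
  by move=> j' /negbTE jj; rewrite !mxE jj !mulr0.
by rewrite !mxE !eqxx !mulr1 /vlift /= xip.
Qed.

Let l (p : T1 * T2) y :=
  crep (chart_at M p : cidx S) E (row_mx (cmap (chart_at M p) p) y).

Lemma reinhart_third_derivative (p : T1 * T2) y u v w :
  reinhart_space V H G nabla -> nonzero2 y -> 'D_u ('D_v ('D_w (l p))) y = 0.
Proof.
move=> HR y0; have c0p := atlas_dom aM p.
have sl := smooth_dw_fibre a1 a2 fF1 fF2 sf1 sf2 c0p.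
apply: (third_derivative_eq0 oP y0 sl) => i j k.
have := reinhart_fund_tensor p (delta_mx 0 k) i j HR y0.
rewrite (dw_derive_fund_tensor a1 a2 fF1 fF2 sf1 sf2 c0p _ _ _ y0) => /eqP.
by rewrite mulf_eq0 invr_eq0 pnatr_eq0 /= => /eqP.
Qed.

(** Directions of the form [row_mx u 0] isolate the first block, and the positive factor [f2^2] is
    cancelled. A point of [T2] and a nonzero [y2] are what complete a slit vector of the first
    factor to a point of the product slit bundle. *)
Lemma reinhart_riemannian1 (y2 : 'rV[R]_n2) : [set: T2] !=set0 -> nonzero y2 ->
  reinhart_space V H G nabla -> is_riemannian M1 F1.
Proof.
move=> [p2 _] y20 HR; apply: (riemannianP a1 fF1) => p1 y1 u v w y10.
have c0p := atlas_dom aM (p1, p2).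
have y0 : nonzero2 (row_mx y1 y2) by rewrite /nonzero2 row_mxKl row_mxKr y10 y20.
have := reinhart_third_derivative (p1, p2) (row_mx u 0) (row_mx v 0) (row_mx w 0)
  HR y0.
rewrite (dw_derive3 f1 f2 a1 a2 fF1 fF2 c0p _ _ _ y0) !row_mxKl !row_mxKr derive0.
rewrite mulr0 addr0 => /eqP; rewrite mulf_eq0 expf_eq0 /= gt_eqF//=.
by move=> /eqP.
Qed.

Lemma reinhart_riemannian2 (y1 : 'rV[R]_n1) : [set: T1] !=set0 -> nonzero y1 ->
  reinhart_space V H G nabla -> is_riemannian M2 F2.
Proof.
move=> [p1 _] y10 HR; apply: (riemannianP a2 fF2) => p2 y2 u v w y20.
have c0p := atlas_dom aM (p1, p2).
have y0 : nonzero2 (row_mx y1 y2) by rewrite /nonzero2 row_mxKl row_mxKr y10 y20.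
have := reinhart_third_derivative (p1, p2) (row_mx 0 u) (row_mx 0 v) (row_mx 0 w)
  HR y0.
rewrite (dw_derive3 f1 f2 a1 a2 fF1 fF2 c0p _ _ _ y0) !row_mxKl !row_mxKr derive0.
rewrite mulr0 add0r => /eqP; rewrite mulf_eq0 expf_eq0 /= gt_eqF//=.
by move=> /eqP.
Qed.

Lemma riemannian_reinhart : is_riemannian M1 F1 -> is_riemannian M2 F2 ->
  reinhart_space V H G nabla.
Proof.
move=> r1 r2 X Y Z sX sY sZ w; set p := (val w).1.
rewrite (nabla_metricE aM PE oP PD sE nablaV w sX sY sZ).
have c0p := atlas_dom aM p; have [h1 h2] := c0p.
have y0 := tan_P0 aM PE PD (w := w) c0p; have /andP[y10 y20] := y0.
apply: big1 => i _; apply: big1 => j _.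
have Xw : lsubmx (X w) = 0.
  by apply/(@mem_verticalP R _ _ M P w); have [_] := sX; exact.
rewrite -[X w]hsubmxK Xw.
have D := dw_derive_fund_tensor a1 a2 fF1 fF2 sf1 sf2 c0p (rsubmx (X w)) i j y0.
have D3 := dw_derive3 f1 f2 a1 a2 fF1 fF2 c0p (rsubmx (X w)) (delta_mx 0 i)
  (delta_mx 0 j) y0.
rewrite (riemannian_third_derivative a1 fF1 _ _ _ r1 h1 y10) in D3.
rewrite (riemannian_third_derivative a2 fF2 _ _ _ r2 h2 y20) in D3.
rewrite !mulr0 addr0 in D3.
by have -> := etrans D (etrans (congr1 _ D3) (mulr0 _)); rewrite mul0r.
Qed.

End Characterization.

Theorem theorem8 (R : realType) (n1 n2 : nat) (T1 T2 : topologicalType)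
    (M1 : charted R T1 n1) (M2 : charted R T2 n2)
    (F1 : T1 * 'rV[R]_n1 -> R) (F2 : T2 * 'rV[R]_n2 -> R)
    (f1 : T1 -> R) (f2 : T2 -> R)
    (n1_gt0 : (0 < n1)%N) (n2_gt0 : (0 < n2)%N)
    (M1_nonempty : [set: T1] !=set0) (M2_nonempty : [set: T2] !=set0)
    (M1_manifold : smooth_manifold M1) (M2_manifold : smooth_manifold M2)
    (F1_finsler : finsler_metric M1 F1) (F2_finsler : finsler_metric M2 F2)
    (f1_smooth : smooth_fun M1 f1) (f2_smooth : smooth_fun M2 f2)
    (f1_gt0 : forall p, 0 < f1 p) (f2_gt0 : forall p, 0 < f2 p)
    (nabla : connection (dw_tbundle M1 M2))
    (nabla_vaisman : vaisman_connection (dw_vertical M1 M2)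
       (dw_horizontal M1 M2 F1 F2 f1 f2)
       (sasaki_matsumoto M1 M2 F1 F2 f1 f2) nabla) :
  reinhart_space (dw_vertical M1 M2) (dw_horizontal M1 M2 F1 F2 f1 f2)
    (sasaki_matsumoto M1 M2 F1 F2 f1 f2) nabla <->
  is_riemannian M1 F1 /\ is_riemannian M2 F2.
Proof.
(* Positive dimension provides a nonzero vector, here the all-ones row, to fill the fibre component
   of the other factor. *)
have const_nonzero m : (0 < m)%N -> nonzero (const_mx 1 : 'rV[R]_m).
  move=> m0; apply/eqP => /rowP/(_ (Ordinal m0)); rewrite !mxE => /eqP.
  by rewrite oner_eq0.
split=> [HR|[r1 r2]]; last exact: riemannian_reinhart.
split.
  exact: (reinhart_riemannian1 M1_manifold M2_manifold F1_finsler F2_finsler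
    f1_smooth f2_smooth f1_gt0 f2_gt0 nabla_vaisman M2_nonempty
    (const_nonzero _ n2_gt0) HR).
exact: (reinhart_riemannian2 M1_manifold M2_manifold F1_finsler F2_finsler
  f1_smooth f2_smooth f1_gt0 f2_gt0 nabla_vaisman M1_nonempty
  (const_nonzero _ n1_gt0) HR).
Qed.
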